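(* If $N$ is a real hypersurface of $\tilde M^{2}(4c)$ with unit normal vector field $\xi$, then $$Ric(J\xi,J\xi)\leq \frac{9}{2}H^2+2c.$$ The equality sign holds identically if and only if $c=0$ and $N$ is totally geodesic.
   Context: $\tilde M^2(4c)$ denotes a complete, simply-connected complex space form of complex dimension $2$, i.e. a Kähler manifold (complex structure $J$, metric $\langle\,,\rangle$) of constant holomorphic sectional curvature $4c$; it is $CP^2(4c)$, $\mathbf C^2$ or $CH^2(4c)$ according to $c>0$, $c=0$, $c<0$. For a real hypersurface $N$ (real dimension $n=3$), $Ric$ is the Ricci tensor of $N$, $\overrightarrow H=\frac1n\,\mathrm{trace}\,\sigma$ is the mean curvature vector ($\sigma$ the second fundamental form), and $H^2=\langle\overrightarrow H,\overrightarrow H\rangle$. *)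

(* Defs.v *)
From HB Require Import structures.
From mathcomp Require Import all_boot all_order all_algebra.
From mathcomp Require Import all_classical all_reals all_analysis.

Set Implicit Arguments.
Unset Strict Implicit.
Unset Printing Implicit Defensive.
Import Order.TTheory GRing.Theory Num.Theory.
Import numFieldNormedType.Exports.
Local Open Scope classical_set_scope.
Local Open Scope ring_scope.

Section Smooth.
Context {R : realType} {V W : normedModType R}.

Fixpoint Ck_on (k : nat) (U : set V) (f : V -> W) : Prop :=
  if k is k'.+1 then
    (forall x, U x -> differentiable f x) /\ (forall v, Ck_on k' U ('D_v f))
  else forall x, U x -> {for x, continuous f}.

Definition smooth_on (U : set V) (f : V -> W) := forall k, Ck_on k U f.

End Smooth.

(* [chart_map i] and [chart_inv i] are total functions; they are mutually
   inverse homeomorphisms only between [dom i] and its image under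
   [chart_map i].  A manifold may be empty or disconnected. *)
Record manifold (R : realType) (n : nat) := Manifold {
  points :> topologicalType;
  points_hausdorff : hausdorff_space points;
  points_second_countable : @second_countable points;
  chart : Type;
  dom : chart -> set points;
  chart_map : chart -> points -> 'rV[R]_n;
  chart_inv : chart -> 'rV[R]_n -> points;
  dom_open : forall i, open (dom i);
  dom_cover : forall p, exists i, dom i p;
  chart_map_open : forall i, open (chart_map i @` dom i);
  chart_mapK : forall i p, dom i p -> chart_inv i (chart_map i p) = p;
  chart_map_continuous : forall i p, dom i p ->
    {for p, continuous (chart_map i)};
  chart_inv_continuous : forall i y, (chart_map i @` dom i) y ->
    {for y, continuous (chart_inv i)};
  transition_smooth : forall i j,
    smooth_on (chart_map i @` (dom i `&` dom j)) (chart_map j \o chart_inv i)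
}.

Section MapsAndMetrics.
Context {R : realType}.

Definition smooth_map n m (N : manifold R n) (M : manifold R m) (f : N -> M) :=
  continuous f /\
  forall (i : chart N) (j : chart M),
    smooth_on (chart_map i @` (dom i `&` f @^-1` dom j))
      (chart_map j \o f \o chart_inv i).

Definition smooth_curve m (M : manifold R m) (gamma : R -> M) :=
  continuous gamma /\
  forall j : chart M, smooth_on (gamma @^-1` dom j) (chart_map j \o gamma).

(* Tangent vectors at [p] are written as row vectors of components in a chart;
   [tangent_map f i j p] is the differential of [f] at [p] read in the chart
   [i] around [p] and the chart [j] around [f p]. *)
Definition tangent_map n m (N : manifold R n) (M : manifold R m) (f : N -> M)
    (i : chart N) (j : chart M) (p : N) (u : 'rV[R]_n) : 'rV[R]_m :=
  'D_u (chart_map j \o f \o chart_inv i) (chart_map i p).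

Definition change n (M : manifold R n) (i j : chart M) (p : M) (u : 'rV[R]_n) :
    'rV[R]_n :=
  'D_u (chart_map j \o chart_inv i) (chart_map i p).

Definition inner n (G : 'M[R]_n) (u v : 'rV[R]_n) : R :=
  (u *m G *m v^T) 0 0.

Definition simply_connected (T : topologicalType) :=
  (forall x y : T, exists gamma : R -> T,
     [/\ {within `[0, 1], continuous gamma}, gamma 0 = x & gamma 1 = y]) /\
  (forall gamma : R -> T, {within `[0, 1], continuous gamma} ->
     gamma 0 = gamma 1 ->
     exists H : R * R -> T,
       {within `[0, 1] `*` `[0, 1], continuous H} /\
       forall s : R, 0 <= s <= 1 ->
         [/\ H (0, s) = gamma s, H (1, s) = gamma 0,
             H (s, 0) = gamma 0 & H (s, 1) = gamma 0]).

End MapsAndMetrics.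

(* [metric i y] is the Gram matrix of the metric in the chart [i] at the point
   of coordinates [y]. *)
Record riemannian (R : realType) (n : nat) := Riemannian {
  mfd :> manifold R n;
  metric : chart mfd -> 'rV[R]_n -> 'M[R]_n;
  metric_smooth : forall i, smooth_on (chart_map i @` dom i) (metric i);
  metric_symmetric : forall i p, dom i p ->
    (metric i (chart_map i p))^T = metric i (chart_map i p);
  metric_pos : forall i p (u : 'rV[R]_n), dom i p -> u != 0 ->
    0 < inner (metric i (chart_map i p)) u u;
  metric_change : forall i j p u v, dom i p -> dom j p ->
    inner (metric i (chart_map i p)) u v =
    inner (metric j (chart_map j p)) (change i j p u) (change i j p v)
}.

(* Levi-Civita calculus in a coordinate domain, for the metric [G]. *)
Section LeviCivita.
Context {R : realType} {n : nat}.
Variable G : 'rV[R]_n -> 'M[R]_n.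

Definition basis_vec (a : 'I_n) : 'rV[R]_n := delta_mx 0 a.

Definition christoffel (k a b : 'I_n) (x : 'rV[R]_n) : R :=
  2^-1 * \sum_(l < n) invmx (G x) k l *
    ('D_(basis_vec a) (fun y => G y b l) x
     + 'D_(basis_vec b) (fun y => G y a l) x
     - 'D_(basis_vec l) (fun y => G y a b) x).

Definition christ (x u v : 'rV[R]_n) : 'rV[R]_n :=
  \row_k \sum_(a < n) \sum_(b < n) christoffel k a b x * u 0 a * v 0 b.

Definition nabla (u : 'rV[R]_n) (Y : 'rV[R]_n -> 'rV[R]_n) (x : 'rV[R]_n) :
    'rV[R]_n :=
  'D_u Y x + christ x u (Y x).

(* R(u,v)w = nabla_u nabla_v w - nabla_v nabla_u w - nabla_[u,v] w; the bracket
   vanishes since u, v, w are extended with constant components. *)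
Definition curvature (x u v w : 'rV[R]_n) : 'rV[R]_n :=
  nabla u (nabla v (cst w)) x - nabla v (nabla u (cst w)) x.

Definition sectional (x u v : 'rV[R]_n) : R :=
  inner (G x) (curvature x u v v) u /
  (inner (G x) u u * inner (G x) v v - inner (G x) u v ^+ 2).

(* Ric(u,v) = trace (w |-> R(w,u)v) *)
Definition ricci (x u v : 'rV[R]_n) : R :=
  \sum_(a < n) (curvature x (basis_vec a) u v) 0 a.

End LeviCivita.

Section SpaceForm.
Context {R : realType}.

Definition is_geodesic n (M : riemannian R n) (gamma : R -> M) :=
  smooth_curve gamma /\
  forall (j : chart M) (t : R), dom j (gamma t) ->
    let x := chart_map j \o gamma in
    derive1 (derive1 x) t
      + christ (metric j) (x t) (derive1 x t) (derive1 x t) = 0.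

Definition geodesically_complete n (M : riemannian R n) :=
  forall (i : chart M) (p : M) (v : 'rV[R]_n), dom i p ->
    exists gamma : R -> M,
      [/\ is_geodesic gamma, gamma 0 = p &
          derive1 (chart_map i \o gamma) 0 = v].

(* Multiplication by the imaginary unit on C^m, for the coordinates
   (x_1, .., x_m, y_1, .., y_m) with z_k = x_k + i y_k. *)
Definition Jmx (m : nat) : 'M[R]_(m + m) := block_mx 0 1%:M (- 1%:M) 0.
Definition J m (u : 'rV[R]_(m + m)) : 'rV[R]_(m + m) := u *m Jmx m.

(* Coordinate changes satisfy the Cauchy-Riemann equations, so that [J], read
   in any chart, is a well-defined complex structure on the tangent spaces. *)
Definition holomorphic_atlas m (M : manifold R (m + m)) :=
  forall (i j : chart M) (p : M) (u : 'rV[R]_(m + m)), dom i p -> dom j p ->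
    change i j p (J u) = J (change i j p u).

(* A Hermitian metric with nabla J = 0; as [J] has constant components in the
   charts, nabla_u (J v) - J (nabla_u v) only involves Christoffel symbols for
   constant [u] and [v]. *)
Definition kahler m (M : riemannian R (m + m)) :=
  [/\ holomorphic_atlas M,
      (forall (i : chart M) (p : M) (u v : 'rV[R]_(m + m)), dom i p ->
         inner (metric i (chart_map i p)) (J u) (J v) =
         inner (metric i (chart_map i p)) u v) &
      (forall (i : chart M) (p : M) (u v : 'rV[R]_(m + m)), dom i p ->
         nabla (metric i) u (cst (J v)) (chart_map i p) =
         J (nabla (metric i) u (cst v) (chart_map i p)))].

Definition constant_holomorphic_curvature m (M : riemannian R (m + m))
    (k : R) :=
  forall (i : chart M) (p : M) (u : 'rV[R]_(m + m)), dom i p -> u != 0 ->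
    sectional (metric i) (chart_map i p) u (J u) = k.

Definition complete_sc_complex_space_form m (M : riemannian R (m + m))
    (k : R) :=
  [/\ kahler M, constant_holomorphic_curvature M k,
      geodesically_complete M & simply_connected (R := R) M].

End SpaceForm.

Section Submanifold.
Context {R : realType} {n m : nat}.
Variables (N : riemannian R n) (M : riemannian R m) (f : N -> M).

Definition isometric_immersion :=
  smooth_map f /\
  forall (i : chart N) (j : chart M) (p : N) (u v : 'rV[R]_n),
    dom i p -> dom j (f p) ->
    inner (metric i (chart_map i p)) u v =
    inner (metric j (chart_map j (f p)))
      (tangent_map f i j p u) (tangent_map f i j p v).

Definition metric_at (j : chart M) (p : N) (u v : 'rV[R]_m) : R :=
  inner (metric j (chart_map j (f p))) u v.

(* [xi j p] : components of the vector at [f p] in the chart [j]. *)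
Definition vector_field_along (xi : chart M -> N -> 'rV[R]_m) :=
  (forall (j k : chart M) (p : N), dom j (f p) -> dom k (f p) ->
     xi k p = change j k (f p) (xi j p)) /\
  (forall (i : chart N) (j : chart M),
     smooth_on (chart_map i @` (dom i `&` f @^-1` dom j))
       (xi j \o chart_inv i)).

Definition unit_normal_field (xi : chart M -> N -> 'rV[R]_m) :=
  vector_field_along xi /\
  forall (i : chart N) (j : chart M) (p : N), dom i p -> dom j (f p) ->
    metric_at j p (xi j p) (xi j p) = 1 /\
    forall u, metric_at j p (xi j p) (tangent_map f i j p u) = 0.

(* Gauss formula: sigma(u,v) = nabla^M_u (df v) - df (nabla^N_u v), where [v]
   is extended with constant components. *)
Definition second_fundamental_form (i : chart N) (j : chart M) (p : N)
    (u v : 'rV[R]_n) : 'rV[R]_m :=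
  let F := chart_map j \o f \o chart_inv i in
  let y := chart_map i p in
  ('D_u ('D_v F) y + christ (metric j) (F y) ('D_u F y) ('D_v F y))
  - 'D_(nabla (metric i) u (cst v) y) F y.

Definition mean_curvature_vector (i : chart N) (j : chart M) (p : N) :
    'rV[R]_m :=
  n%:R^-1 *: \sum_(a < n) \sum_(b < n) invmx (metric i (chart_map i p)) a b *:
    second_fundamental_form i j p (basis_vec a) (basis_vec b).

Definition mean_curvature_sq (i : chart N) (j : chart M) (p : N) : R :=
  metric_at j p (mean_curvature_vector i j p) (mean_curvature_vector i j p).

Definition totally_geodesic :=
  forall (i : chart N) (j : chart M) (p : N) (u v : 'rV[R]_n),
    dom i p -> dom j (f p) -> second_fundamental_form i j p u v = 0.

End Submanifold.

Lemma JK (R : realType) m (u : 'rV[R]_(m + m)) : J (J u) = - u.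
Proof.
rewrite /J -mulmxA /Jmx mulmx_block.
rewrite !(mul0mx, mulmx0, mul1mx, mulmx1, add0r, addr0).
have -> : block_mx (- 1%:M) 0 0 (- 1%:M) = - 1%:M :> 'M[R]_(m + m).
  by rewrite [1%:M in RHS]scalar_mx_block opp_block_mx !oppr0.
by rewrite mulmxN mulmx1.
Qed.

Lemma innerC (R : realType) n (G : 'M[R]_n) u v :
  G^T = G -> inner G u v = inner G v u.
Proof.
move=> sG; rewrite /inner.
have -> : u *m G *m v^T = (v *m G *m u^T)^T.
  by rewrite !trmx_mul trmxK sG mulmxA.
by rewrite mxE.
Qed.

(* J xi is tangent to N: it is the image of a vector [u] of N, unique since [f]
   is isometric; Ric(J xi, J xi) is Ric(u, u) for this [u]. *)
Lemma J_normal_tangent (R : realType) (M : riemannian R (2 + 2))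
    (N : riemannian R 3) (f : N -> M) (xi : chart M -> N -> 'rV[R]_(2 + 2)) :
  kahler M -> isometric_immersion f -> unit_normal_field f xi ->
  forall (i : chart N) (j : chart M) p, dom i p -> dom j (f p) ->
  exists u, tangent_map f i j p u = J (m:=2) (xi j p).
Proof.
move=> [_ herm _] [[_ smf] iso] [_ nor] i j p ip jp.
set y := chart_map i p; set F := chart_map j \o f \o chart_inv i.
have dF : differentiable F y.
  have [+ _] := smf i j 1%N; apply; exists p => //; split => //.
have tE u : tangent_map f i j p u = u *m jacobian F y by exact: deriveEjacobian.
have {nor} [n1 n0] := nor i j p ip jp.
rewrite /metric_at in n1 n0.
set G := metric j _ in n1 n0.
have sG : G^T = G by exact: metric_symmetric jp.
have free : row_free (jacobian F y).
  apply/inj_row_free => u u0; apply/eqP/negPn/negP => un0.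
  have := metric_pos ip un0.
  by rewrite (iso i j p u u ip jp) !tE u0 /inner !mul0mx mxE ltxx.
set a := G *m (xi j p)^T.
have sub w : inner G w (xi j p) = 0 -> (w <= kermx a)%MS.
  move=> w0; apply/sub_kermxP/matrixP => r s.
  by rewrite !ord1 [RHS]mxE /a mulmxA.
have JS : (jacobian F y <= kermx a)%MS.
  apply/row_subP => r; apply: sub; rewrite rowE -tE innerC //.
have Ja : (J (m:=2) (xi j p) <= kermx a)%MS.
  apply: sub; set x := xi j p.
  have := herm j (f p) (J (m:=2) x) x jp; rewrite JK -/G.
  rewrite {1}/inner !mulNmx mxE -/(inner G x (J x)) innerC // => /eqP.
  by rewrite eq_sym -addr_eq0 -mulr2n mulrn_eq0 /= => /eqP.
have ra : (\rank (kermx a) <= 3)%N.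
  rewrite mxrank_ker; suff : \rank a != 0%N.
    by case: (\rank a) => // r _; exact: (leq_subr r 3).
  rewrite mxrank_eq0; apply/eqP => a0.
  by move: n1; rewrite /inner -mulmxA -/a a0 mulmx0 mxE => /eqP;
    rewrite eq_sym oner_eq0.
have eqs : (kermx a <= jacobian F y)%MS.
  by rewrite -(geq_leqif (mxrank_leqif_sup JS)) (eqP free).
have /submxP[u uE] := submx_trans Ja eqs.
by exists u; rewrite tE uE.
Qed.

(* Main.v *)
(** Let [A] be the shape operator and [U = J xi].  In an orthonormal frame
    [U, e, Je] of the hypersurface the Gauss equation reads
    Ric(U,U) = 2c + h11 (h22 + h33) - h12^2 - h13^2, while
    9/2 H^2 = (h11 + h22 + h33)^2 / 2; hence 9/2 H^2 + 2c - Ric(U,U) is the sum of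
    squares h11^2/2 + (h22 + h33)^2/2 + h12^2 + h13^2.

    Equality everywhere means that [A U = 0] and that [A] is symmetric and
    trace-free on the complex line field [D] orthogonal to [U], so that [A]
    anticommutes with [J] there.  The Codazzi equation in the direction [U] then
    gives [A^2 = -c] on [D].  If c = 0, then [A = 0], and c > 0 is impossible.
    If c < 0, let [tau] be a section of [D] with [A tau = l tau], l^2 = -c.  The
    Codazzi equation in the directions [tau] and [J tau] shows that the derivative
    of [tau] has no [J tau] component, and this is incompatible with the value of
    the ambient curvature <R(tau, J tau) tau, J tau>. *)

Require Import Defs.
From HB Require Import structures.
From mathcomp Require Import all_boot all_order all_algebra.
From mathcomp Require Import all_classical all_reals all_analysis.
From mathcomp Require Import ring lra.
Import Order.TTheory GRing.Theory Num.Theory.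
Import numFieldNormedType.Exports.
Local Open Scope classical_set_scope.
Local Open Scope ring_scope.

Set Implicit Arguments.
Unset Strict Implicit.
Unset Printing Implicit Defensive.

(* The delicate point of the case c < 0 is the eigenfield. Since A^2 = l^2 on D, the vector l e + A
   e is an eigenvector for every e in D, so the D-part of a constant coordinate field [u0] yields a
   smooth [tau] by a formula, with no choice of frame. Such a [tau] may have zeros. Expansions in
   xi, J xi, tau, J tau are therefore multiplied by |tau|^2 instead of being divided by it, and the
   argument ends with [tau = 0] for every [u0]. This says A = - l on D, which contradicts the
   vanishing trace.

   All computations take place along the map, in one pair of charts, with the pullback of the
   ambient connection: a field such as xi lives on N and is never extended to M. The Codazzi
   equation is used in the form of the ambient curvature acting on xi, so the covariant derivative
   of the second fundamental form does not appear. *)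
Opaque derive.

(** * Smooth functions *)

Section Germs.
Context {R : realType} {V W : normedModType R}.
Implicit Types (f g : V -> W) (U : set V).

(** The difference of the two functions vanishes near [x], so it has differential 0 with a remainder
    that is eventually 0. *)
Lemma differentiable_near f g (x : V) :
  (\near x, f x = g x) -> differentiable f x -> differentiable g x.
Proof.
move=> fg df.
suff dh (h : V -> W) : (\near x, h x = 0) -> differentiable h x.
  have -> : g = f + (g - f) by rewrite addrC subrK.
  apply: (differentiableD df); apply: dh.
  by apply: filterS fg => y fy; rewrite !fctE fy subrr.
move=> h0; have hx : h x = 0 := nbhs_singleton h0.
have c0 : continuous (0 : V -> W) by exact: cst_continuous.
have hE : h \o shift x = cst (h x) + (\0 : V -> W) +o_ 0 id.
  apply/eqaddoP => e e0; near=> y.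
  have -> : (h \o shift x - (cst (h x) + \0)) y = h (y + x).
    by rewrite -[LHS]/(h (y + x) - (h x + 0)) hx addr0 subr0.
  suff -> : h (y + x) = 0 by rewrite normr0 mulr_ge0 // ltW.
  near: y; move: h0; rewrite (near_shift (0 : V) x).
  by apply: filterS => z /=; rewrite /= subr0.
apply/diff_locallyP.
by rewrite (diff_unique (df := \0) c0 hE).
Unshelve. all: by end_near. Qed.

Lemma eq_on_near U f g (x : V) : open U -> U x ->
  (forall y, U y -> f y = g y) -> \near x, f x = g x.
Proof. by move=> oU Ux fg; near=> y; apply: fg; near: y; exact: open_nbhs_nbhs. 
Unshelve. all: by end_near. Qed.

Lemma derive_eq_on U f g (x v : V) : open U -> U x ->
  (forall y, U y -> f y = g y) -> 'D_v f x = 'D_v g x.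
Proof. by move=> oU Ux fg; apply: near_eq_derive; exact: eq_on_near fg. Qed.

End Germs.

Section CkTheory.
Context {R : realType} {V : normedModType R}.
Implicit Types (U : set V) (k : nat).

Lemma Ck_on_sub (W : normedModType R) k (U U' : set V) (f : V -> W) :
  U' `<=` U -> Ck_on k U f -> Ck_on k U' f.
Proof.
move=> sU; elim: k f => [|k IH] f /=; first by move=> H x /sU; exact: H.
by move=> [d D]; split => [x /sU /d //|v]; exact: IH.
Qed.

(** A formula for a derivative is valid only at points of [U]; openness lets it be differentiated
    again. The closure properties below use this to feed such formulas into their inductions on
    [k]. *)
Lemma Ck_on_ext (W : normedModType R) k U (f g : V -> W) : open U ->
  (forall y, U y -> f y = g y) -> Ck_on k U f -> Ck_on k U g.
Proof.
move=> oU; elim: k f g => [|k IH] f g fg /=.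
  move=> cf x Ux; have := cf x Ux; rewrite /prop_for /continuous_at -(fg x Ux).
  by apply: cvg_trans; apply: near_eq_cvg; exact: eq_on_near oU Ux fg.
move=> [df Df]; split => [x Ux|v].
  by apply: differentiable_near (df x Ux); exact: eq_on_near oU Ux fg.
by apply: IH (Df v) => y Uy; exact: derive_eq_on oU Uy fg.
Qed.

Lemma Ck_onW (W : normedModType R) k U (f : V -> W) :
  Ck_on k.+1 U f -> Ck_on k U f.
Proof.
elim: k f => [|k IH] f /=.
  by move=> [d _] x Ux; exact: differentiable_continuous (d x Ux).
by move=> [d D]; split => // v; apply: IH; exact: D.
Qed.

Lemma Ck_on_cst (W : normedModType R) k U (a : W) : Ck_on k U (cst a).
Proof.
elim: k a => [|k IH] a /=; first by move=> x _; exact: cst_continuous.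
split=> [x _|v]; first exact: differentiable_cst.
by rewrite (_ : 'D_v _ = cst 0) //; apply/funext => x; rewrite derive_cst.
Qed.

Lemma Ck_onD (W : normedModType R) k U (f g : V -> W) : open U ->
  Ck_on k U f -> Ck_on k U g -> Ck_on k U (f + g).
Proof.
move=> oU; elim: k f g => [|k IH] f g /=.
  by move=> cf cg x Ux; apply: continuousD; [exact: cf|exact: cg].
move=> [df Df] [dg Dg]; split=> [x Ux|v].
  by apply: differentiableD; [exact: df|exact: dg].
apply: (Ck_on_ext oU _ (IH _ _ (Df v) (Dg v))) => y Uy.
by rewrite deriveD //; apply: diff_derivable; [exact: df|exact: dg].
Qed.

Lemma Ck_onZ (W : normedModType R) k U (a : R) (f : V -> W) : open U ->
  Ck_on k U f -> Ck_on k U (a *: f).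
Proof.
move=> oU; elim: k f => [|k IH] f /=.
  by move=> cf x Ux; apply: continuousZl_tmp; exact: cf.
move=> [df Df]; split=> [x Ux|v].
  by apply: differentiableZ; exact: df.
apply: (Ck_on_ext oU _ (IH _ (Df v))) => y Uy.
by rewrite deriveZ //; apply: diff_derivable; exact: df.
Qed.

Lemma Ck_on_sum (W : normedModType R) k U (I : Type) (r : seq I) (P : pred I)
    (f : I -> V -> W) : open U -> (forall i, P i -> Ck_on k U (f i)) ->
  Ck_on k U (\sum_(i <- r | P i) f i).
Proof.
move=> oU Hf; elim/big_ind : _ => //; first exact: Ck_on_cst.
by move=> g h; exact: Ck_onD.
Qed.

Lemma Ck_onM k U (f g : V -> R) : open U ->
  Ck_on k U f -> Ck_on k U g -> Ck_on k U (f * g).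
Proof.
move=> oU; elim: k f g => [|k IH] f g.
  by move=> cf cg x Ux; apply: continuousM; [exact: cf|exact: cg].
move=> Cf Cg; have [df Df] := Cf; have [dg Dg] := Cg; split=> [x Ux|v].
  by apply: differentiableM; [exact: df|exact: dg].
apply: (Ck_on_ext (f := f * 'D_v g + g * 'D_v f) oU).
  by move=> y Uy; rewrite deriveM //; apply: diff_derivable; [exact: df|exact: dg].
by apply: Ck_onD => //; apply: IH;
  [exact: Ck_onW Cf|exact: Dg|exact: Ck_onW Cg|exact: Df].
Qed.

Lemma Ck_onV k U (f : V -> R) : open U -> (forall x, U x -> f x != 0) ->
  Ck_on k U f -> Ck_on k U (fun x => (f x)^-1).
Proof.
move=> oU f0; elim: k => [|k IH].
  by move=> cf x Ux; apply: continuousV; [exact: f0|exact: cf].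
move=> Cf; have [df Df] := Cf; split=> [x Ux|v].
  by apply: differentiableV; [exact: df|exact: f0].
have /IH Ci := Ck_onW Cf.
(* The derivative of 1/f is written with 1/f twice rather than with 1/f^2, so that the induction
   hypothesis applies to each factor. *)
apply: (Ck_on_ext (f := (-1) *: ((fun x => (f x)^-1) * (fun x => (f x)^-1) * 'D_v f)) oU).
  move=> y Uy; rewrite deriveV ?f0 //; last by apply: diff_derivable; exact: df.
  by rewrite !fctE /= -exprVn expr2 /GRing.scale /= mulN1r mulNr.
by apply: Ck_onZ => //; apply: Ck_onM => //; [exact: Ck_onM|exact: Df].
Qed.

Lemma differentiable_mx m n (f : V -> 'M[R]_(m, n)) (x : V) :
  (forall i j, differentiable (fun y => f y i j) x) -> differentiable f x.
Proof.
move=> df.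
have -> : f = \sum_(i < m) \sum_(j < n) (fun y => f y i j *: delta_mx i j).
  apply/funext => y; rewrite [LHS]matrix_sum_delta fct_sumE; apply: eq_bigr => i _.
  by rewrite fct_sumE.
apply: differentiable_sum => i; apply: differentiable_sum => j.
exact: differentiableZl.
Qed.

Lemma differentiable_entry m n (f : V -> 'M[R]_(m, n)) (x : V) i j :
  differentiable f x -> differentiable (fun y => f y i j) x.
Proof.
move=> df; apply: (differentiable_comp (g := fun N : 'M[R]_(m, n) => N i j)) df _.
exact: differentiable_coord.
Qed.

Lemma derive_entry m n (f : V -> 'M[R]_(m, n)) (x v : V) i j :
  differentiable f x -> 'D_v f x i j = 'D_v (fun y => f y i j) x.
Proof. by move=> df; rewrite derive_mx ?mxE //; exact: diff_derivable. Qed.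

Lemma Ck_on_mxP k U m n (f : V -> 'M[R]_(m, n)) : open U ->
  Ck_on k U f <-> forall i j, Ck_on k U (fun y => f y i j).
Proof.
move=> oU; split.
  move=> Cf i j; elim: k f Cf => [|k IH] f /=.
    move=> cf x Ux.
    exact: (continuous_comp (cf x Ux) (@coord_continuous R m n i j (f x))).
  move=> [df Df]; split=> [x Ux|v]; first exact: differentiable_entry (df x Ux).
  apply: (Ck_on_ext oU _ (IH _ (Df v))) => y Uy.
  by rewrite derive_entry //; exact: df.
move=> Cf.
have -> : f = \sum_(i < m) \sum_(j < n) (fun y => f y i j *: delta_mx i j).
  apply/funext => y; rewrite [LHS]matrix_sum_delta fct_sumE; apply: eq_bigr => i _.
  by rewrite fct_sumE.
apply: Ck_on_sum => // i _; apply: Ck_on_sum => // j _.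
suff H (g : V -> R) :
    Ck_on k U g -> Ck_on k U (fun y => g y *: delta_mx i j : 'M[R]_(m, n)).
  exact: H (Cf i j).
elim: k g {Cf} => [|k IH] g; first by move=> cg x Ux; apply: continuousZr_tmp; exact: cg.
move=> [dg Dg]; split=> [x Ux|v]; first exact/differentiableZl/dg.
apply: (Ck_on_ext oU _ (IH _ (Dg v))) => y Uy.
rewrite !deriveE; last 2 first.
- exact/differentiableZl/dg.
- exact: dg.
by rewrite diffZl //; exact: dg.
Qed.

End CkTheory.

(** * Symmetry of mixed second derivatives *)

Section Schwarz.
Context {R : realType} {V : normedModType R}.

Lemma is_derive_line (f : V -> R) (x v : V) (s : R) :
  differentiable f (x + s *: v) ->
  is_derive s 1 (fun t : R => f (x + t *: v)) ('D_v f (x + s *: v)).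
Proof.
move=> df.
have ds : is_diff s ( *:%R ^~ v : R -> V) ( *:%R ^~ v) by exact: is_diff_scalel.
have dl : is_diff s (fun t : R => x + t *: v) (0 + ( *:%R ^~ v)).
  exact: (@is_diffD _ _ _ (cst x) _ _ _ _ (is_diff_cst _ _) ds).
have dc : differentiable (f \o (fun t : R => x + t *: v)) s.
  by apply: differentiable_comp => //; exact: ex_diff.
apply: DeriveDef; first exact: diff_derivable dc.
rewrite (deriveE _ dc) (diff_comp (@ex_diff _ _ _ _ _ _ _ dl) df) /= diff_val.
by rewrite !fctE add0r scale1r deriveE.
Qed.

(* Applied to [u, v] and to [v, u], this evaluates the same second difference. *)
Lemma second_difference (f : V -> R) (x u v : V) (h : R) (B : set V) :
  0 < h -> (forall s t, 0 <= s <= h -> 0 <= t <= h -> B (x + s *: u + t *: v)) ->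
  (forall y, B y -> differentiable f y) ->
  (forall y, B y -> differentiable ('D_u f) y) ->
  exists2 z, B z &
    f (x + h *: u + h *: v) - f (x + h *: u) - f (x + h *: v) + f x =
    'D_v ('D_u f) z * h ^+ 2.
Proof.
move=> h0 Bx df Ddf.
have hh : 0 <= h <= h by rewrite lexx ltW.
have z0h : 0 <= (0 : R) <= h by rewrite lexx ltW.
have in01 s : s \in `]0, h[%R -> 0 <= s <= h.
  by rewrite in_itv /= => /andP[/ltW -> /ltW ->].
have inc s : s \in `[0, h]%R -> 0 <= s <= h by rewrite in_itv.
pose phi s := f (x + h *: v + s *: u) - f (x + s *: u).
pose dphi s := 'D_u f (x + h *: v + s *: u) - 'D_u f (x + s *: u).
have dphiE s : 0 <= s <= h -> is_derive s (1 : R) phi (dphi s).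
  move=> sh.
  have B1 := Bx s h sh hh; have B0 := Bx s 0 sh z0h.
  rewrite scale0r addr0 in B0; rewrite addrAC in B1.
  by apply: is_deriveB; apply: is_derive_line; exact: df.
have [s sh phiE] : exists2 s, s \in `]0, h[%R & phi h - phi 0 = dphi s * (h - 0).
  apply: (MVT h0 (fun s hs => dphiE s (in01 s hs))).
  apply: continuous_in_subspaceT => s; rewrite inE => /inc sh.
  by apply/differentiable_continuous/derivable1_diffP; have := dphiE s sh => -[].
have {}sh := in01 _ sh.
pose psi t := 'D_u f (x + s *: u + t *: v).
pose dpsi t := 'D_v ('D_u f) (x + s *: u + t *: v).
have dpsiE t : 0 <= t <= h -> is_derive t (1 : R) psi (dpsi t).
  by move=> th; apply: is_derive_line; apply: Ddf; exact: Bx.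
have [t th psiE] : exists2 t, t \in `]0, h[%R &
    psi h - psi 0 = dpsi t * (h - 0).
  apply: (MVT h0 (fun t ht => dpsiE t (in01 t ht))).
  apply: continuous_in_subspaceT => t; rewrite inE => /inc th.
  by apply/differentiable_continuous/derivable1_diffP; have := dpsiE t th => -[].
exists (x + s *: u + t *: v); first by apply: Bx => //; exact: in01.
have : dphi s = psi h - psi 0.
  by rewrite /dphi /psi scale0r addr0 [x + s *: u + _]addrAC.
rewrite psiE => dE; move: phiE; rewrite dE !subr0 /phi scale0r !addr0.
by rewrite expr2 mulrA => <-; rewrite [x + h *: v + _]addrAC; ring.
Qed.

(** The same second difference equals h^2 times either mixed derivative, each at some point of a
    small parallelogram at [x]. By continuity both values are within e/2 of the values at [x]. *)
Lemma schwarz_real U (f : V -> R) (x u v : V) : open U -> U x -> Ck_on 2 U f ->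
  'D_u ('D_v f) x = 'D_v ('D_u f) x.
Proof.
move=> oU Ux [df Df].
have tri (a b z e : R) : `|b - z| < e / 2 -> `|a - z| < e / 2 -> `|a - b| <= e.
  by rewrite !ltr_norml ler_norml => /andP[? ?] /andP[? ?]; apply/andP; split; lra.
have cD a b : {for x, continuous ('D_a ('D_b f))} by have [_ /(_ a)] := Df b; apply.
apply/eqP; rewrite -subr_eq0 -normr_le0; apply/ler_addgt0Pl => e e0; rewrite addr0.
have e2 : 0 < e / 2 by rewrite divr_gt0.
pose B := [set y | [/\ U y, `|'D_u ('D_v f) x - 'D_u ('D_v f) y| < e / 2
   & `|'D_v ('D_u f) x - 'D_v ('D_u f) y| < e / 2]].
have /nbhs_ballP[r r0 rB] : nbhs x B.
  have UN : nbhs x U by exact: open_nbhs_nbhs.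
  have /cvgrPdist_lt/(_ _ e2) N1 := cD u v.
  have /cvgrPdist_lt/(_ _ e2) N2 := cD v u.
  by apply: filterS3 UN N1 N2 => y y1 y2 y3; exact: And3 y1 y2 y3.
(* The summand 1 keeps [d] positive when [u] and [v] vanish. Then [h * d = r / 2] places the
   parallelogram of sides [h u], [h v] inside the ball of radius [r]. *)
pose d := `|u| + `|v| + 1.
have d0 : 0 < d by rewrite ltr_wpDl // addr_ge0.
pose h := r / 2 / d.
have h0 : 0 < h by rewrite !divr_gt0.
have Bx a b s t : `|a| + `|b| + 1 = d -> 0 <= s <= h -> 0 <= t <= h ->
    B (x + s *: a + t *: b).
  move=> dE /andP[s0 sh] /andP[t0 th]; apply: rB; rewrite -ball_normE /=.
  rewrite -addrA opprD addNKr normrN (le_lt_trans (ler_normD _ _)) //.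
  rewrite !normrZ !ger0_norm //.
  have : h * d = r / 2 by rewrite /h divfK // gt_eqF.
  rewrite -dE; have := ler_wpM2r (normr_ge0 a) sh.
  have := ler_wpM2r (normr_ge0 b) th; move: r0 h0 => /=; lra.
have [z [_ _ z2] zE] : exists2 z, B z & f (x + h *: u + h *: v) - f (x + h *: u) -
    f (x + h *: v) + f x = 'D_v ('D_u f) z * h ^+ 2.
  apply: second_difference h0 _ _ _ => [s t|y [Uy _ _]|y [Uy _ _]]; first exact: Bx.
    exact: df.
  by have [+ _] := Df u; apply.
have [w [_ w1 _] wE] : exists2 z, B z & f (x + h *: v + h *: u) - f (x + h *: v) -
    f (x + h *: u) + f x = 'D_u ('D_v f) z * h ^+ 2.
  apply: second_difference h0 _ _ _ => [s t|y [Uy _ _]|y [Uy _ _]].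
  - by apply: Bx; rewrite [`|v| + _]addrC.
  - exact: df.
  by have [+ _] := Df v; apply.
have zw : 'D_v ('D_u f) z = 'D_u ('D_v f) w.
  have h2 : h ^+ 2 != 0 by rewrite expf_neq0 // gt_eqF.
  have eq : f (x + h *: u + h *: v) - f (x + h *: u) - f (x + h *: v) + f x =
            f (x + h *: v + h *: u) - f (x + h *: v) - f (x + h *: u) + f x.
    by rewrite [x + h *: v + _]addrAC; congr (_ + _); rewrite [LHS]addrAC.
  exact: (mulIf h2 (etrans (esym zE) (etrans eq wE))).
rewrite zw in z2; exact: tri z2 w1.
Qed.

Lemma schwarz U m n (f : V -> 'M[R]_(m, n)) (x u v : V) :
  open U -> U x -> Ck_on 2 U f -> 'D_u ('D_v f) x = 'D_v ('D_u f) x.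
Proof.
move=> oU Ux Cf; have [df Df] := Cf.
apply/matrixP => i j.
have H a b : 'D_a ('D_b f) x i j = 'D_a ('D_b (fun y => f y i j)) x.
  rewrite derive_entry; last by have [+ _] := Df b; apply.
  apply: derive_eq_on oU Ux _ => y Uy; rewrite derive_entry //; exact: df.
refine (etrans (H u v) (etrans _ (esym (H v u)))).
exact: (schwarz_real u v oU Ux ((Ck_on_mxP 2 f oU).1 Cf i j)).
Qed.

End Schwarz.

Section Smooth.
Context {R : realType} {V : normedModType R}.
Variables (U : set V).
Hypothesis oU : open U.

Lemma smooth_on_diff (W : normedModType R) (f : V -> W) x :
  smooth_on U f -> U x -> differentiable f x.
Proof. by move=> /(_ 1%N)[+ _]; apply. Qed.

Lemma smooth_on_derive (W : normedModType R) (f : V -> W) v :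
  smooth_on U f -> smooth_on U ('D_v f).
Proof. by move=> sf k; have [_] := sf k.+1; apply. Qed.

Lemma smooth_on_ext (W : normedModType R) (f g : V -> W) :
  (forall y, U y -> f y = g y) -> smooth_on U f -> smooth_on U g.
Proof. by move=> fg sf k; exact: Ck_on_ext fg (sf k). Qed.

Lemma smooth_on_sub (W : normedModType R) U' (f : V -> W) :
  U' `<=` U -> smooth_on U f -> smooth_on U' f.
Proof. by move=> sU sf k; exact: Ck_on_sub sU (sf k). Qed.

Lemma smooth_on_cst (W : normedModType R) (a : W) : smooth_on U (fun _ => a).
Proof. by move=> k; exact: Ck_on_cst. Qed.

Lemma smooth_onD (W : normedModType R) (f g : V -> W) :
  smooth_on U f -> smooth_on U g -> smooth_on U (fun y => f y + g y).
Proof. by move=> sf sg k; exact: Ck_onD. Qed.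

Lemma smooth_onZ (W : normedModType R) (a : R) (f : V -> W) :
  smooth_on U f -> smooth_on U (fun y => a *: f y).
Proof. by move=> sf k; exact: Ck_onZ. Qed.

Lemma smooth_onN (W : normedModType R) (f : V -> W) :
  smooth_on U f -> smooth_on U (fun y => - f y).
Proof.
by move=> /(smooth_onZ (-1)); apply: smooth_on_ext => y _; rewrite scaleN1r.
Qed.

Lemma smooth_onB (W : normedModType R) (f g : V -> W) :
  smooth_on U f -> smooth_on U g -> smooth_on U (fun y => f y - g y).
Proof. by move=> sf sg; apply: smooth_onD => //; exact: smooth_onN. Qed.

Lemma smooth_onM (f g : V -> R) :
  smooth_on U f -> smooth_on U g -> smooth_on U (fun y => f y * g y).
Proof. by move=> sf sg k; exact: Ck_onM. Qed.

Lemma smooth_onV (f : V -> R) : (forall x, U x -> f x != 0) ->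
  smooth_on U f -> smooth_on U (fun y => (f y)^-1).
Proof. by move=> f0 sf k; exact: Ck_onV. Qed.

Lemma smooth_on_sum (W : normedModType R) (I : Type) (r : seq I) (P : pred I)
    (f : I -> V -> W) : (forall i, P i -> smooth_on U (f i)) ->
  smooth_on U (fun y => \sum_(i <- r | P i) f i y).
Proof.
move=> sf k; rewrite -fct_sumE; apply: Ck_on_sum => // i Pi; exact: sf.
Qed.

Lemma smooth_on_prod (I : Type) (r : seq I) (P : pred I)
    (f : I -> V -> R) : (forall i, P i -> smooth_on U (f i)) ->
  smooth_on U (fun y => \prod_(i <- r | P i) f i y).
Proof.
move=> sf; elim: r => [|i r IH].
  by apply: smooth_on_ext _ (smooth_on_cst (1 : R)) => y _; rewrite big_nil.
have [Pi|Pi] := boolP (P i).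
  apply: smooth_on_ext _ (smooth_onM (sf i Pi) IH) => y _; by rewrite big_cons Pi.
by apply: smooth_on_ext _ IH => y _; rewrite big_cons (negPf Pi).
Qed.

Lemma smooth_on_mxP m n (f : V -> 'M[R]_(m, n)) :
  smooth_on U f <-> forall i j, smooth_on U (fun y => f y i j).
Proof.
split=> [sf i j k|sf k]; first by move: i j; apply/(Ck_on_mxP k f oU).
by apply/(Ck_on_mxP k f oU) => i j; exact: sf.
Qed.

Lemma smooth_on_entry m n (f : V -> 'M[R]_(m, n)) i j :
  smooth_on U f -> smooth_on U (fun y => f y i j).
Proof. by move=> /smooth_on_mxP. Qed.

Lemma smooth_on_mulmx m n p (f : V -> 'M[R]_(m, n)) (g : V -> 'M[R]_(n, p)) :
  smooth_on U f -> smooth_on U g -> smooth_on U (fun y => f y *m g y).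
Proof.
move=> sf sg; apply/smooth_on_mxP => i j.
apply: (smooth_on_ext (f := fun y => \sum_k f y i k * g y k j)).
  by move=> y _; rewrite mxE.
by apply: smooth_on_sum => k _; apply: smooth_onM; exact: smooth_on_entry.
Qed.

Lemma smooth_on_trmx m n (f : V -> 'M[R]_(m, n)) :
  smooth_on U f -> smooth_on U (fun y => (f y)^T).
Proof.
move=> sf; apply/smooth_on_mxP => i j.
apply: smooth_on_ext _ (smooth_on_entry j i sf) => y _; by rewrite mxE.
Qed.

Lemma smooth_on_det n (f : V -> 'M[R]_n) :
  smooth_on U f -> smooth_on U (fun y => \det (f y)).
Proof.
move=> sf; apply: smooth_on_sum => s _; apply: smooth_onM; first exact: smooth_on_cst.
by apply: smooth_on_prod => i _; exact: smooth_on_entry.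
Qed.

(** Cramer's rule: the entries of the inverse are cofactors divided by the determinant. *)
Lemma smooth_on_invmx n (f : V -> 'M[R]_n) : (forall y, U y -> f y \in unitmx) ->
  smooth_on U f -> smooth_on U (fun y => invmx (f y)).
Proof.
move=> fu sf; apply/smooth_on_mxP => i j.
apply: (smooth_on_ext (f := fun y => (\det (f y))^-1 * cofactor (f y) j i)).
  by move=> y Uy; rewrite /invmx fu // !mxE.
apply: smooth_onM.
  apply: smooth_onV; last exact: smooth_on_det.
  by move=> y Uy; rewrite -unitfE -unitmxE fu.
apply: smooth_onM; first exact: smooth_on_cst.
apply: smooth_on_det; apply/smooth_on_mxP => k l.
by apply: smooth_on_ext _ (smooth_on_entry (lift j k) (lift i l) sf) => y _; rewrite !mxE.
Qed.

End Smooth.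

Section ProductRules.
Context {R : realType} {V : normedModType R}.

Lemma is_derive_entry m n (f : V -> 'M[R]_(m, n)) (x v : V) i j :
  differentiable f x -> is_derive x v (fun y => f y i j) ('D_v f x i j).
Proof.
move=> df; apply: DeriveDef; last by rewrite derive_entry.
by apply: diff_derivable; exact: differentiable_entry.
Qed.

Lemma differentiable_mulmx m n p (f : V -> 'M[R]_(m, n)) (g : V -> 'M[R]_(n, p)) x :
  differentiable f x -> differentiable g x -> differentiable (fun y => f y *m g y) x.
Proof.
move=> df dg; apply: differentiable_mx => i j.
have -> : (fun y => (f y *m g y) i j) = \sum_k (fun y => f y i k * g y k j).
  by apply/funext => y; rewrite mxE fct_sumE.
apply: differentiable_sum => k.
by apply: (differentiableM (f := fun y => f y i k) (g := fun y => g y k j));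
  exact: differentiable_entry.
Qed.

Lemma derive_mulmx m n p (f : V -> 'M[R]_(m, n)) (g : V -> 'M[R]_(n, p)) x v :
  differentiable f x -> differentiable g x ->
  'D_v (fun y => f y *m g y) x = 'D_v f x *m g x + f x *m 'D_v g x.
Proof.
move=> df dg; apply/matrixP => i j.
rewrite derive_entry; last exact: differentiable_mulmx.
have -> : (fun y => (f y *m g y) i j) = \sum_k (fun y => f y i k * g y k j).
  by apply/funext => y; rewrite mxE fct_sumE.
have H k : is_derive x v (fun y => f y i k * g y k j)
    (f x i k *: 'D_v g x k j + g x k j *: 'D_v f x i k).
  exact: (is_deriveM (is_derive_entry v i k df) (is_derive_entry v k j dg)).
have := @is_derive_sum _ _ _ _ _ x v _ H.
move=> /@derive_val ->; rewrite !mxE -big_split /=; apply: eq_bigr => k _.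
by rewrite addrC [_ *: 'D_v f x i k]mulrC.
Qed.

Lemma differentiable_trmx m n (f : V -> 'M[R]_(m, n)) x :
  differentiable f x -> differentiable (fun y => (f y)^T) x.
Proof.
move=> df; apply: differentiable_mx => i j.
by have -> : (fun y => (f y)^T i j) = (fun y => f y j i)
  by [apply/funext => y; rewrite mxE|]; exact: differentiable_entry.
Qed.

Lemma derive_trmx m n (f : V -> 'M[R]_(m, n)) x v :
  differentiable f x -> 'D_v (fun y => (f y)^T) x = ('D_v f x)^T.
Proof.
move=> df; apply/matrixP => i j; rewrite derive_entry; last exact: differentiable_trmx.
rewrite mxE derive_entry //; congr ('D_v _ x).
by apply/funext => y; rewrite mxE.
Qed.

Lemma derive_inner n (G : V -> 'M[R]_n) (X Y : V -> 'rV[R]_n) x v :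
  differentiable G x -> differentiable X x -> differentiable Y x ->
  'D_v (fun y => inner (G y) (X y) (Y y)) x =
  inner ('D_v G x) (X x) (Y x) + inner (G x) ('D_v X x) (Y x)
  + inner (G x) (X x) ('D_v Y x).
Proof.
move=> dG dX dY; rewrite /inner.
have dYT := differentiable_trmx dY.
have dXG := differentiable_mulmx dX dG.
rewrite -derive_entry; last exact: differentiable_mulmx.
rewrite !derive_mulmx // derive_trmx // mulmxDl !mxE.
by congr (_ + _); rewrite addrC.
Qed.

Lemma deriveZ_dir (W : normedModType R) (f : V -> W) x a u : differentiable f x ->
  'D_(a *: u) f x = a *: 'D_u f x.
Proof. by move=> df; rewrite !deriveE // linearZ. Qed.

Lemma derive_comp (V' W : normedModType R) (f : V -> V') (g : V' -> W) x u :
  differentiable f x -> differentiable g (f x) ->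
  'D_u (g \o f) x = 'D_('D_u f x) g (f x).
Proof.
move=> df dg; rewrite !deriveE //; last exact: differentiable_comp.
by rewrite diff_comp.
Qed.

End ProductRules.

Section Composition.
Context {R : realType} {V : normedModType R} {m : nat}.
Variables (U : set V) (U' : set 'rV[R]_m) (F : V -> 'rV[R]_m).
Hypotheses (oU : open U) (FU : forall x, U x -> U' (F x)).

Lemma derive_basis (W : normedModType R) (g : 'rV[R]_m -> W) y u : differentiable g y ->
  'D_u g y = \sum_k u 0 k *: 'D_(basis_vec k) g y.
Proof.
move=> dg; rewrite {1}[u]row_sum_delta deriveE // linear_sum; apply: eq_bigr => k _.
by rewrite linearZ deriveE.
Qed.

(** [Ck_on] differentiates in fixed directions, whereas the chain rule differentiates [g] in the
    moving direction ['D_v F y]. Expanding the latter in the basis restores fixed directions, at the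
    price of smooth coefficients. *)
Lemma Ck_on_comp k (g : 'rV[R]_m -> R) : Ck_on k U F -> Ck_on k U' g ->
  Ck_on k U (g \o F).
Proof.
elim: k g => [|k IH] g.
  move=> cF cg x Ux; exact: (continuous_comp (cF x Ux) (cg _ (FU Ux))).
move=> CF [dg Dg]; have [dF DF] := CF; have CFk := Ck_onW CF.
split=> [x Ux|v]; first by apply: differentiable_comp; [exact: dF|exact: dg (FU Ux)].
apply: (Ck_on_ext (f := \sum_j (fun y => 'D_v F y 0 j) * ('D_(basis_vec j) g \o F)) oU).
  move=> y Uy; rewrite derive_comp; [|exact: dF|exact: dg (FU Uy)].
  by rewrite (derive_basis _ (dg _ (FU Uy))) fct_sumE.
apply: Ck_on_sum => // j _; apply: Ck_onM => //; last exact: IH CFk (Dg _).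
by move: (0 : 'I_1) j; apply/(Ck_on_mxP k _ oU); exact: DF.
Qed.

Lemma smooth_on_comp n p (g : 'rV[R]_m -> 'M[R]_(n, p)) :
  open U' -> smooth_on U F -> smooth_on U' g ->
  smooth_on U (fun x => g (F x)).
Proof.
move=> oU' sF sg; apply/(smooth_on_mxP oU) => i j k.
apply: (Ck_on_comp (g := fun y => g y i j) (sF k)).
exact: (Ck_on_mxP k g oU').1 (sg k) i j.
Qed.

End Composition.

(** * Inner products and frames *)

Section Inner.
Context {R : realType} {n : nat}.
Implicit Types (G : 'M[R]_n) (u v w : 'rV[R]_n).

Lemma innerE G u v : inner G u v = \sum_a \sum_b u 0 a * G a b * v 0 b.
Proof.
rewrite /inner mxE exchange_big /=; apply: eq_bigr => b _.
by rewrite !mxE mulr_suml.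
Qed.

Lemma innerDl G u v w : inner G (u + v) w = inner G u w + inner G v w.
Proof. by rewrite /inner !mulmxDl mxE. Qed.
Lemma innerDr G u v w : inner G u (v + w) = inner G u v + inner G u w.
Proof. by rewrite /inner linearD /= mulmxDr mxE. Qed.
Lemma innerZl G a u v : inner G (a *: u) v = a * inner G u v.
Proof. by rewrite /inner -!scalemxAl mxE. Qed.
Lemma innerZr G a u v : inner G u (a *: v) = a * inner G u v.
Proof. by rewrite /inner linearZ /= -scalemxAr mxE. Qed.
Lemma innerNl G u v : inner G (- u) v = - inner G u v.
Proof. by rewrite -scaleN1r innerZl mulN1r. Qed.
Lemma innerNr G u v : inner G u (- v) = - inner G u v.
Proof. by rewrite -scaleN1r innerZr mulN1r. Qed.
Lemma innerBl G u v w : inner G (u - v) w = inner G u w - inner G v w.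
Proof. by rewrite innerDl innerNl. Qed.
Lemma innerBr G u v w : inner G u (v - w) = inner G u v - inner G u w.
Proof. by rewrite innerDr innerNr. Qed.
Lemma inner0l G u : inner G 0 u = 0.
Proof. by rewrite /inner !mul0mx mxE. Qed.
Lemma inner0r G u : inner G u 0 = 0.
Proof. by rewrite /inner linear0 mulmx0 mxE. Qed.
Lemma inner_suml G (I : Type) (r : seq I) (P : pred I) (f : I -> 'rV[R]_n) v :
  inner G (\sum_(i <- r | P i) f i) v = \sum_(i <- r | P i) inner G (f i) v.
Proof.
by elim/big_rec2 : _ => [|i y x _ <-]; rewrite ?inner0l ?innerDl.
Qed.
Lemma inner_sumr G (I : Type) (r : seq I) (P : pred I) (f : I -> 'rV[R]_n) v :
  inner G v (\sum_(i <- r | P i) f i) = \sum_(i <- r | P i) inner G v (f i).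
Proof.
by elim/big_rec2 : _ => [|i y x _ <-]; rewrite ?inner0r ?innerDr.
Qed.

Definition posdef G := forall u, u != 0 -> 0 < inner G u u.

Lemma posdef_inner_eq0 G u : posdef G -> inner G u u = 0 -> u = 0.
Proof.
move=> pG u0; apply/eqP/negPn/negP => /pG; by rewrite u0 ltxx.
Qed.

Lemma posdef_unitmx G : posdef G -> G \in unitmx.
Proof.
move=> pG; rewrite -row_free_unit; apply/inj_row_free => u u0.
by apply: (posdef_inner_eq0 pG); rewrite /inner u0 mul0mx mxE.
Qed.

End Inner.

Section OrthogonalVectors.
Context {R : realType}.

Lemma orthogonal_pair n (g : 'M[R]_n) (x y : 'rV[R]_n) : (2 < n)%N ->
  exists e, [/\ e != 0, inner g e x = 0 & inner g e y = 0].
Proof.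
move=> n2; pose a := row_mx (g *m x^T) (g *m y^T).
have : kermx a != 0.
  by rewrite -mxrank_eq0 mxrank_ker -lt0n subn_gt0 (leq_ltn_trans (rank_leq_col a)).
move=> /rowV0Pn[e /sub_kermxP ea e0]; exists e; split=> //.
all: move: ea; rewrite mul_mx_row !mulmxA -[0]row_mx0 => /eq_row_mx[ex ey].
  by rewrite /inner ex mxE.
by rewrite /inner ey mxE.
Qed.

(** As [x] is not isotropic, its orthogonal is a hyperplane. The row space of [A] lies in it and has
    the same dimension, so the two coincide. *)
Lemma orthogonal_submx n p (g : 'M[R]_n) (A : 'M[R]_(p, n)) (x y : 'rV[R]_n) :
  n = p.+1 -> row_free A -> inner g x x != 0 ->
  (forall u, inner g (u *m A) x = 0) -> inner g y x = 0 -> (y <= A)%MS.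
Proof.
move=> np free xx Ax yx; pose a := g *m x^T.
have aE z : inner g z x = (z *m a) 0 0 by rewrite /inner mulmxA.
have sub z : inner g z x = 0 -> (z <= kermx a)%MS.
  by move=> z0; apply/sub_kermxP/matrixP => i j; rewrite !ord1 -aE z0 mxE.
have As : (A <= kermx a)%MS by apply/row_subP => r; apply: sub; rewrite rowE.
have a0 : a != 0 by apply: contra_neq xx => a0; rewrite aE a0 mulmx0 mxE.
have ra : (\rank (kermx a) <= \rank A)%N.
  rewrite (eqP free) mxrank_ker; have : \rank a != 0%N by rewrite mxrank_eq0.
  by case: (\rank a) => // r _; rewrite np subSS leq_subr.
by apply: submx_trans (sub y yx) _; rewrite -(geq_leqif (mxrank_leqif_sup As)).
Qed.

End OrthogonalVectors.

Section OrthonormalFrame.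
Context {R : realType} {n : nat} (g : 'M[R]_n) (p : 'I_n -> 'rV[R]_n).
Hypotheses (gT : g^T = g) (po : forall i j, inner g (p i) (p j) = (i == j)%:R).

Let P : 'M[R]_n := \matrix_(i, j) p i 0 j.

Let rowE k : row k P = p k.
Proof. by apply/rowP => j; rewrite !mxE. Qed.

Let inner_rows (A B : 'M[R]_n) i j : (A *m g *m B^T) i j = inner g (row i A) (row j B).
Proof.
by rewrite /inner -row_mul !mxE; apply: eq_bigr => k _; rewrite !mxE.
Qed.

Let Pg : P *m g *m P^T = 1%:M.
Proof. by apply/matrixP => i j; rewrite inner_rows !rowE po mxE. Qed.

(** For square matrices a right inverse is a left inverse, so orthonormality of the frame becomes
    completeness: [P^T *m P] is the inverse Gram matrix. *)
Let gP : g *m (P^T *m P) = 1%:M.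
Proof. by rewrite mulmxA; apply: mulmx1C; rewrite mulmxA. Qed.

Lemma frame_invmx a b : invmx g a b = \sum_k p k 0 a * p k 0 b.
Proof.
have gu : g \in unitmx by have [] := mulmx1_unit gP.
have -> : invmx g = P^T *m P by rewrite -[RHS](mulKmx gu) gP mulmx1.
by rewrite mxE; apply: eq_bigr => k _; rewrite !mxE.
Qed.

Lemma frame_coord (x : 'rV[R]_n) a : x 0 a = \sum_k inner g x (p k) * p k 0 a.
Proof.
have xE : x = x *m g *m P^T *m P by rewrite -!mulmxA gP mulmx1.
rewrite {1}xE mxE; apply: eq_bigr => k _; rewrite [P _ _]mxE; congr (_ * _).
rewrite /inner !mxE; apply: eq_bigr => b _; by rewrite !mxE.
Qed.

Lemma frame_parseval x y : inner g x y = \sum_k inner g x (p k) * inner g y (p k).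
Proof.
have xE : x = \sum_k inner g x (p k) *: p k.
  by apply/rowP => a; rewrite summxE {1}frame_coord; apply: eq_bigr => k _; rewrite mxE.
rewrite {1}xE inner_suml; apply: eq_bigr => k _.
by rewrite innerZl (innerC (p k) y gT).
Qed.

Lemma frame_trace_linear (f : 'I_n -> 'rV[R]_n -> R) :
  (forall k x, f k x = \sum_a x 0 a * f k (delta_mx 0 a)) -> 
  \sum_a \sum_k f k (delta_mx 0 a) * p k 0 a = \sum_k f k (p k).
Proof.
move=> fl; rewrite exchange_big /=; apply: eq_bigr => k _.
by rewrite fl; apply: eq_bigr => a _; rewrite mulrC.
Qed.

End OrthonormalFrame.

(** * The Levi-Civita connection *)

Section TripleSum.
Context {R : realType} {n : nat}.
Implicit Types (T : 'I_n -> 'I_n -> 'I_n -> R) (u v w : 'rV[R]_n).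

Definition triple_sum T u v w := \sum_a \sum_b \sum_l u 0 a * v 0 b * w 0 l * T a b l.

(** The Koszul formula as a pure index computation; [T a b l] stands for the derivative in direction
    [a] of the metric coefficient with indices [b], [l]. *)
Lemma koszul_sum (g : 'M[R]_n) T u v w : g^T = g -> g \in unitmx ->
  inner g (\row_k \sum_a \sum_b
     (2^-1 * \sum_l invmx g k l * (T a b l + T b a l - T l a b)) * u 0 a * v 0 b) w =
  2^-1 * (triple_sum T u v w + triple_sum T v u w - triple_sum T w u v).
Proof.
move=> sg ug.
(* [kap] is the covector given by the Christoffel symbols of the first kind; raising its index gives
   the row vector of the statement. *)
pose kap : 'rV[R]_n :=
  \row_l (2^-1 * \sum_a \sum_b u 0 a * v 0 b * (T a b l + T b a l - T l a b)).
set X := \row_k _.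
have -> : X = kap *m invmx g.
  apply/rowP => k; rewrite [RHS]mxE mxE.
  transitivity (\sum_a \sum_b \sum_l
    2^-1 * (u 0 a * v 0 b) * (T a b l + T b a l - T l a b) * invmx g l k).
    apply: eq_bigr => a _; apply: eq_bigr => b _.
    rewrite !(mulr_sumr, mulr_suml); apply: eq_bigr => l _.
    have -> : invmx g k l = invmx g l k by rewrite -{1}sg -trmx_inv mxE.
    ring.
  under eq_bigr => a _ do rewrite exchange_big /=.
  rewrite exchange_big /=; apply: eq_bigr => l _.
  rewrite mxE !(mulr_sumr, mulr_suml); apply: eq_bigr => a _.
  by rewrite !(mulr_sumr, mulr_suml); apply: eq_bigr => b _; ring.
rewrite /inner mulmxKV // mxE /triple_sum.
have -> : \sum_a \sum_b \sum_l v 0 a * u 0 b * w 0 l * T a b l =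
    \sum_a \sum_b \sum_l u 0 a * v 0 b * w 0 l * T b a l.
  rewrite exchange_big /=; apply: eq_bigr => a _; apply: eq_bigr => b _.
  by apply: eq_bigr => l _; rewrite [v 0 b * _]mulrC.
have -> : \sum_a \sum_b \sum_l w 0 a * u 0 b * v 0 l * T a b l =
    \sum_a \sum_b \sum_l u 0 a * v 0 b * w 0 l * T l a b.
  rewrite exchange_big /=; apply: eq_bigr => a _.
  rewrite exchange_big /=; apply: eq_bigr => b _; apply: eq_bigr => l _.
  ring.
rewrite -big_split -sumrB /= mulr_sumr.
transitivity (\sum_l \sum_a \sum_b
  2^-1 * (u 0 a * v 0 b * w 0 l) * (T a b l + T b a l - T l a b)).
  apply: eq_bigr => l _; rewrite !mxE !(mulr_sumr, mulr_suml); apply: eq_bigr => a _.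
  by rewrite !(mulr_sumr, mulr_suml); apply: eq_bigr => b _; ring.
rewrite exchange_big /=; apply: eq_bigr => a _.
rewrite exchange_big /= -big_split -sumrB /= mulr_sumr; apply: eq_bigr => b _.
rewrite -big_split -sumrB /= mulr_sumr; apply: eq_bigr => l _.
ring.
Qed.

End TripleSum.

Section Christoffel.
Context {R : realType} {n : nat}.
Variable G : 'rV[R]_n -> 'M[R]_n.
Implicit Types x u v w : 'rV[R]_n.

Definition chmx (k : 'I_n) x : 'M[R]_n := \matrix_(a, b) christoffel G k a b x.

Lemma christE x u v k : christ G x u v 0 k = inner (chmx k x) u v.
Proof.
rewrite mxE innerE; apply: eq_bigr => a _; apply: eq_bigr => b _.
by rewrite mxE [christoffel _ _ _ _ _ * _]mulrC.
Qed.

Lemma christDr x u v w : christ G x u (v + w) = christ G x u v + christ G x u w.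
Proof. by apply/rowP => k; rewrite [RHS]mxE !christE innerDr. Qed.
Let T x a b l := 'D_(basis_vec a) (fun y => G y b l) x.

Lemma inner_derive x u v w : differentiable G x ->
  inner ('D_u G x) v w = triple_sum (T x) u v w.
Proof.
move=> dG; rewrite (derive_basis u dG) /triple_sum exchange_big /= innerE.
apply: eq_bigr => b _; rewrite exchange_big /=; apply: eq_bigr => l _.
rewrite summxE mulr_sumr mulr_suml; apply: eq_bigr => a _.
rewrite mxE; have := derive_entry (basis_vec a) b l dG; rewrite -/(T x a b l) => ->.
by move: (T x a b l) => t; ring.
Qed.

Lemma christ_koszul x u v w : differentiable G x -> (G x)^T = G x -> G x \in unitmx ->
  inner (G x) (christ G x u v) w =
  2^-1 * (inner ('D_u G x) v w + inner ('D_v G x) u w - inner ('D_w G x) u v).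
Proof.
move=> dG sG uG; rewrite (inner_derive u v w dG) (inner_derive v u w dG).
rewrite (inner_derive w u v dG); exact: koszul_sum.
Qed.

Lemma christ_sym x u v : (forall a b l, T x a b l = T x a l b) ->
  christ G x u v = christ G x v u.
Proof.
move=> sT; apply/rowP => k; rewrite !christE innerC //.
apply/matrixP => a b; rewrite !mxE.
suff H c d : christoffel G k c d x =
    2^-1 * \sum_l invmx (G x) k l * (T x c d l + T x d c l - T x l c d).
  rewrite !H; congr (_ * _); apply: eq_bigr => l _; congr (_ * _).
  by rewrite (sT l) [T x b a l + _]addrC.
by [].
Qed.

End Christoffel.

Opaque inner christ.

Definition metric_patch (R : realType) n (W : set 'rV[R]_n) (G : 'rV[R]_n -> 'M[R]_n) :=
  [/\ open W, smooth_on W G, (forall x, W x -> (G x)^T = G x) &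
      forall x, W x -> posdef (G x)].

Section Patch.
Context {R : realType} {n : nat} {W : set 'rV[R]_n} {G : 'rV[R]_n -> 'M[R]_n}.
Hypothesis GW : metric_patch W G.

Lemma patch_diff x : W x -> differentiable G x.
Proof. by case: GW => _ sG _ _; exact: smooth_on_diff. Qed.

Lemma patch_sym x : W x -> (G x)^T = G x. Proof. by case: GW => _ _ + _; apply. Qed.

Lemma patch_derive_sym x u : W x -> ('D_u G x)^T = 'D_u G x.
Proof.
move=> Wx; rewrite -derive_trmx; last exact: patch_diff.
by case: GW => oW _ sG _; exact: derive_eq_on oW Wx sG.
Qed.

Lemma patch_unit x : W x -> G x \in unitmx.
Proof. by move=> Wx; apply: posdef_unitmx; case: GW => _ _ _; apply. Qed.

Lemma smooth_on_chmx k : smooth_on W (chmx G k).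
Proof.
case: (GW) => oW sG _ _.
apply/(smooth_on_mxP oW) => a b.
pose T a b l := 'D_(basis_vec a) (fun y => G y b l).
apply: (smooth_on_ext oW (f := fun x => 2^-1 * \sum_l invmx (G x) k l *
   (T a b l x + T b a l x - T l a b x))).
  by move=> x Wx; rewrite mxE.
have sT c d e : smooth_on W (T c d e).
  by apply: smooth_on_derive; apply: smooth_on_entry.
apply: smooth_onM => //; first exact: smooth_on_cst.
apply: smooth_on_sum => // l _; apply: smooth_onM => //.
  by apply: smooth_on_entry => //; apply: smooth_on_invmx => //; exact: patch_unit.
by apply: smooth_onB => //; exact: smooth_onD.
Qed.

Lemma patch_christ_sym x u v : W x -> christ G x u v = christ G x v u.
Proof.
move=> Wx; apply: christ_sym => a b l; case: GW => oW _ sG _.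
by apply: derive_eq_on oW Wx _ => y /sG; move=> {2}<-; rewrite mxE.
Qed.

Lemma patch_koszul x u v w : W x ->
  inner (G x) (christ G x u v) w =
  2^-1 * (inner ('D_u G x) v w + inner ('D_v G x) u w - inner ('D_w G x) u v).
Proof.
move=> Wx; apply: christ_koszul.
- exact: patch_diff.
- exact: patch_sym.
- exact: patch_unit.
Qed.

(** Compatibility with the metric. In the sum of the two Koszul formulas the derivatives along [v]
    and [w] cancel, and the one along [u] occurs twice with factor 1/2. *)
Lemma patch_metric x u v w : W x ->
  inner ('D_u G x) v w =
  inner (G x) (christ G x u v) w + inner (G x) v (christ G x u w).
Proof.
move=> Wx; rewrite (innerC v (christ G x u w) (patch_sym Wx)) !patch_koszul //.
have E (p p' q r : R) : p = p' -> p = 2^-1 * (p + q - r) + 2^-1 * (p' + r - q).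
  by move=> ->; field.
by apply: E; apply: innerC; exact: patch_derive_sym.
Qed.

End Patch.

Lemma derive_inner_cst (R : realType) (V : normedModType R) n (G : V -> 'M[R]_n) a b x v :
  differentiable G x ->
  'D_v (fun y => inner (G y) a b) x = inner ('D_v G x) a b.
Proof.
move=> dG.
rewrite (derive_inner v dG (differentiable_cst a x) (differentiable_cst b x)).
have d0 (c : 'rV[R]_n) : 'D_v (cst c) x = 0 by exact: derive_cst.
by rewrite (d0 a) (d0 b) inner0l inner0r !addr0.
Qed.

Section SmoothInner.
Context {R : realType} {V : normedModType R} (U : set V).
Hypothesis oU : open U.

Lemma smooth_on_inner n (A : V -> 'M[R]_n) (X Y : V -> 'rV[R]_n) :
  smooth_on U A -> smooth_on U X -> smooth_on U Y ->
  smooth_on U (fun y => inner (A y) (X y) (Y y)).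
Proof.
move=> sA sX sY; apply: smooth_on_entry => //.
apply: smooth_on_mulmx => //; last exact: smooth_on_trmx.
exact: smooth_on_mulmx.
Qed.

Lemma smooth_on_scale n (f : V -> R) (X : V -> 'rV[R]_n) :
  smooth_on U f -> smooth_on U X -> smooth_on U (fun y => f y *: X y).
Proof.
move=> sf sX; apply/(smooth_on_mxP oU) => i j.
apply: (smooth_on_ext oU (f := fun y => f y * X y i j)).
  by move=> y _; rewrite mxE.
by apply: smooth_onM => //; exact: smooth_on_entry.
Qed.

End SmoothInner.

Lemma differentiable_christ (R : realType) n (W : set 'rV[R]_n) (G : 'rV[R]_n -> 'M[R]_n)
    x u v : metric_patch W G -> W x -> differentiable (fun x => christ G x u v) x.
Proof.
move=> GW Wx; have [oW _ _ _] := GW; apply: differentiable_mx => i k; rewrite ord1.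
have -> : (fun x => christ G x u v 0 k) = (fun x => inner (chmx G k x) u v).
  by apply/funext => y; rewrite christE.
exact: (smooth_on_diff (smooth_on_inner oW (smooth_on_chmx GW k)
  (smooth_on_cst W u) (smooth_on_cst W v)) Wx).
Qed.

(** * Vector fields along a map and the pullback connection *)

Section Along.
Context {R : realType} {n p : nat} {W : set 'rV[R]_n} {G : 'rV[R]_n -> 'M[R]_n}.
Context {V : set 'rV[R]_p} {F : 'rV[R]_p -> 'rV[R]_n}.
Hypotheses (GW : metric_patch W G) (oV : open V) (sF : smooth_on V F)
  (FW : forall y, V y -> W (F y)).

(* The pullback along [F] of the Levi-Civita connection of [G]. *)
Definition cov (u : 'rV[R]_p) (X : 'rV[R]_p -> 'rV[R]_n) (y : 'rV[R]_p) : 'rV[R]_n :=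
  'D_u X y + christ G (F y) ('D_u F y) (X y).

Let oW : open W. Proof. by case: GW. Qed.

Lemma smooth_on_christ (A B : 'rV[R]_p -> 'rV[R]_n) :
  smooth_on V A -> smooth_on V B ->
  smooth_on V (fun y => christ G (F y) (A y) (B y)).
Proof.
move=> sA sB; apply/(smooth_on_mxP oV) => i k; rewrite ord1.
apply: (smooth_on_ext oV (f := fun y => inner (chmx G k (F y)) (A y) (B y))).
  by move=> y _; rewrite christE.
apply: smooth_on_inner => //.
by apply: (smooth_on_comp oV FW) => //; exact: smooth_on_chmx.
Qed.

Lemma smooth_on_cov u X : smooth_on V X -> smooth_on V (cov u X).
Proof.
move=> sX; apply: smooth_onD => //; first exact: smooth_on_derive.
by apply: smooth_on_christ => //; exact: smooth_on_derive.
Qed.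

(** Leibniz rule for a bilinear expression whose coefficients depend on the base point [F y]; the
    first term comes from the motion of that point. *)
Lemma derive_christ u (A B : 'rV[R]_p -> 'rV[R]_n) y : V y ->
  smooth_on V A -> smooth_on V B ->
  'D_u (fun y => christ G (F y) (A y) (B y)) y =
  'D_('D_u F y) (fun x => christ G x (A y) (B y)) (F y)
  + christ G (F y) ('D_u A y) (B y) + christ G (F y) (A y) ('D_u B y).
Proof.
move=> Vy sA sB.
have dA := smooth_on_diff sA Vy; have dB := smooth_on_diff sB Vy.
have dF := smooth_on_diff sF Vy; have WF := FW Vy.
have dc k : differentiable (chmx G k) (F y).
  exact: smooth_on_diff (smooth_on_chmx GW k) WF.
have dcc a b := differentiable_christ a b GW WF.
apply/rowP => k.
rewrite derive_entry; last exact: smooth_on_diff (smooth_on_christ sA sB) Vy.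
rewrite 2![in RHS]mxE (derive_entry _ _ _ (dcc _ _)) !christE.
have -> : (fun x => christ G x (A y) (B y) 0 k) =
    (fun x => inner (chmx G k x) (A y) (B y)).
  by apply/funext => x; rewrite christE.
have -> : (fun y => christ G (F y) (A y) (B y) 0 k) =
    (fun y => inner (chmx G k (F y)) (A y) (B y)).
  by apply/funext => x; rewrite christE.
rewrite (derive_inner _ _ dA dB); last exact: (differentiable_comp dF (dc k)).
have -> : 'D_u (fun y => chmx G k (F y)) y = 'D_('D_u F y) (chmx G k) (F y).
  exact: derive_comp.
by rewrite (derive_inner_cst _ _ _ (dc k)).
Qed.

Lemma cov_metric u X Y y : V y -> smooth_on V X -> smooth_on V Y ->
  'D_u (fun y => inner (G (F y)) (X y) (Y y)) y =
  inner (G (F y)) (cov u X y) (Y y) + inner (G (F y)) (X y) (cov u Y y).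
Proof.
move=> Vy sX sY.
have dF := smooth_on_diff sF Vy; have dG := patch_diff GW (FW Vy).
rewrite (derive_inner _ _ (smooth_on_diff sX Vy) (smooth_on_diff sY Vy)); last first.
  exact: (differentiable_comp dF dG).
have -> : 'D_u (fun y => G (F y)) y = 'D_('D_u F y) G (F y) by exact: derive_comp.
rewrite (patch_metric GW _ _ _ (FW Vy)) /cov innerDl innerDr.
have E (a b c d : R) : a + b + c + d = c + a + (d + b) by ring.
exact: E.
Qed.

(** Torsion-freeness for the images of commuting coordinate fields: the second derivatives of [F]
    commute and the Christoffel symbols are symmetric. *)
Lemma cov_torsion u v y : V y -> cov u ('D_v F) y = cov v ('D_u F) y.
Proof.
move=> Vy; refine (congr2 _ (schwarz u v oV Vy (sF 2)) _).
exact (patch_christ_sym GW _ _ (FW Vy)).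
Qed.

Lemma curvatureE x u v w : curvature G x u v w =
  'D_u (fun x => christ G x v w) x + christ G x u (christ G x v w)
  - ('D_v (fun x => christ G x u w) x + christ G x v (christ G x u w)).
Proof.
have nE a : nabla G a (cst w) = (fun x => christ G x a w).
  by apply/funext => z; rewrite /nabla derive_cst add0r.
by rewrite /curvature !nE.
Qed.

(** The curvature of the pullback connection is the pullback of the curvature. After expansion, the
    second derivatives of [X] and of [F] cancel by Schwarz, the first derivatives of [X] cancel in
    pairs, and only the terms of [curvatureE] remain. *)
Lemma cov_curvature u v X y : V y -> smooth_on V X ->
  cov u (cov v X) y - cov v (cov u X) y =
  curvature G (F y) ('D_u F y) ('D_v F y) (X y).
Proof.
move=> Vy sX.
have sDF w := smooth_on_derive w sF.
have sDX w := smooth_on_derive w sX.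
have E a b : cov a (cov b X) y = 'D_a ('D_b X) y +
   ('D_('D_a F y) (fun x => christ G x ('D_b F y) (X y)) (F y)
  + christ G (F y) ('D_a ('D_b F) y) (X y) + christ G (F y) ('D_b F y) ('D_a X y))
  + (christ G (F y) ('D_a F y) ('D_b X y) +
    christ G (F y) ('D_a F y) (christ G (F y) ('D_b F y) (X y))).
  rewrite {1}/cov {2}/cov christDr; congr (_ + _).
  rewrite /cov deriveD; last 2 first.
  - exact: diff_derivable (smooth_on_diff (sDX b) Vy).
  - exact: diff_derivable (smooth_on_diff (smooth_on_christ (sDF b) sX) Vy).
  by rewrite derive_christ.
have alg (a a' b c c' d e f g h : 'rV[R]_n) : a = a' -> c = c' ->
    a + (b + c + d) + (e + f) - (a' + (g + c' + e) + (d + h)) = b + f - (g + h).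
  by move=> -> ->; apply/rowP => k; rewrite !mxE; ring.
refine (etrans (congr2 (fun p q => p - q) (E u v) (E v u))
  (etrans _ (esym (curvatureE _ _ _ _)))).
apply: alg; first exact: schwarz oV Vy (sX 2).
exact (congr1 (fun z => christ G (F y) z (X y)) (schwarz u v oV Vy (sF 2))).
Qed.

End Along.

(** * Curvature of complex space forms *)

Section CurvatureLike.
Context {R : realType} {E : zmodType}.
Variable Q : E -> E -> E -> E -> R.
Hypotheses (Q12 : forall x y z w, Q x y z w = - Q y x z w)
  (Q34 : forall x y z w, Q x y z w = - Q x y w z)
  (Qb : forall x y z w, Q x y z w + Q y z x w + Q z x y w = 0)
  (QD4 : forall x y z w w', Q x y z (w + w') = Q x y z w + Q x y z w').

(** The classical octahedron argument: four instances of the Bianchi identity, combined by means of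
    the two antisymmetries. Pair symmetry then carries additivity from the last argument to the
    others. *)
Lemma curvature_pair x y z w : Q x y z w = Q z w x y.
Proof.
have := (Qb x y z w, Qb y z w x, Qb z w x y, Qb w x y z).
have := (Q34 x y z w, Q34 y z x w, Q12 z x y w, Q34 x z y w).
have := (Q34 z w y x, Q12 w y z x, Q34 y w z x, Q34 w x z y).
by move=> [[[? ?] ?] ?] [[[? ?] ?] ?] [[[? ?] ?] ?]; lra.
Qed.

Lemma curvatureD3 x y z z' w : Q x y (z + z') w = Q x y z w + Q x y z' w.
Proof. by rewrite Q34 QD4 (Q34 x y z) (Q34 x y z') opprD. Qed.
Lemma curvatureD2 x y y' z w : Q x (y + y') z w = Q x y z w + Q x y' z w.
Proof.
by rewrite curvature_pair QD4 (curvature_pair x y) (curvature_pair x y').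
Qed.
Lemma curvatureD1 x x' y z w : Q (x + x') y z w = Q x y z w + Q x' y z w.
Proof. by rewrite Q12 curvatureD2 (Q12 x) (Q12 x') opprD. Qed.

Lemma curvature04 x y z : Q x y z 0 = 0.
Proof. by apply: (addrI (Q x y z 0)); rewrite -QD4 !addr0. Qed.
Lemma curvatureN4 x y z w : Q x y z (- w) = - Q x y z w.
Proof. by apply/eqP; rewrite -addr_eq0 -QD4 addNr curvature04. Qed.
Lemma curvatureN3 x y z w : Q x y (- z) w = - Q x y z w.
Proof. by rewrite Q34 curvatureN4 [in RHS]Q34. Qed.
Lemma curvatureN2 x y z w : Q x (- y) z w = - Q x y z w.
Proof. by rewrite curvature_pair curvatureN4 [in RHS]curvature_pair. Qed.
Lemma curvatureN1 x y z w : Q (- x) y z w = - Q x y z w.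
Proof. by rewrite Q12 curvatureN2 [in RHS]Q12. Qed.

(** Polarizing in the two inner arguments and then in the two outer ones makes [Q] invariant under
    cyclic permutation of its last three arguments, so that the Bianchi identity becomes 3 Q = 0. *)
Lemma sectional0_curvature0 : (forall x y, Q x y y x = 0) ->
  forall x y z w, Q x y z w = 0.
Proof.
move=> Q0.
have Qx x y z : Q x y z x = 0.
  have := Q0 x (y + z); rewrite curvatureD2 !curvatureD3.
  have := (Q0 x y, Q0 x z, curvature_pair x z y x, Q12 y x x z, Q34 x y x z).
  by move=> [[[[? ?] ?] ?] ?]; lra.
have Qa x y z w : Q x y z w = - Q w y z x.
  have := Qx (x + w) y z; rewrite curvatureD1 !QD4 !Qx; lra.
move=> x y z w.
have cyc a b c d : Q a b c d = Q a c d b.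
  rewrite Qa curvature_pair Q12; lra.
have := Qb w z y x.
have := (cyc x y z w, cyc x z w y).
have := (curvature_pair x y z w, Q12 z w x y, Q34 w z x y).
have := (curvature_pair x z w y, Q12 w y x z, Q34 y w x z).
have := (curvature_pair x w y z, Q12 y z x w, Q34 z y x w).
by move=> [[? ?] ?] [[? ?] ?] [[? ?] ?] [? ?]; lra.
Qed.

Variable j : E -> E.
Hypotheses (jD : forall x y, j (x + y) = j x + j y) (jj : forall x, j (j x) = - x)
  (Qj : forall x y z w, Q x y (j z) (j w) = Q x y z w).

Lemma curvature_j1 x y z w : Q (j x) (j y) z w = Q x y z w.
Proof. by rewrite curvature_pair Qj -curvature_pair. Qed.

(* With [A = Q(x,jy,jy,x)], [B = Q(x,y,y,x)] and [C = Q(x,jx,jy,y)], the part of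
   [Q(x+y,j(x+y),j(x+y),x+y)] quadratic in [y] gives [C = -2A], and the Bianchi
   identity gives [C = A + B]; so [B = -3A], whence [B = 9B] on replacing [y] by
   [jy]. *)
Lemma holomorphic0_curvature0 : (forall x, Q x (j x) (j x) x = 0) ->
  forall x y z w, Q x y z w = 0.
Proof.
move=> Q0; apply: sectional0_curvature0.
suff H x y : Q x y y x = - 3 * Q x (j y) (j y) x.
  move=> x y; have := H x y; have := H x (j y).
  by rewrite jj curvatureN2 curvatureN3; lra.
have jN z : j (- z) = - j z by rewrite -{1}(jj z) jj.
have CA : 2 * Q x (j x) (j y) y + 4 * Q x (j y) (j y) x = 0.
  (* Adding the two expansions removes the terms of odd degree in [y]; those of degree 0 and 4
     vanish by [Q0]. *)
  have := Q0 (x + y); have := Q0 (x - y); rewrite !jD !jN.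
  rewrite !(curvatureD1, curvatureD2, curvatureD3, QD4).
  rewrite !(curvatureN1, curvatureN2, curvatureN3, curvatureN4) !Q0.
  have E1 : Q y (j y) (j x) x = Q x (j x) (j y) y.
    by rewrite curvature_pair Q12 Q34 opprK.
  have E2 : Q y (j x) (j y) x = Q x (j y) (j y) x.
    by rewrite -curvature_j1 jj curvatureN2 Q12 opprK.
  have E3 : Q x (j y) (j x) y = Q x (j y) (j y) x.
    by rewrite -Qj jj curvatureN3 Q34 opprK.
  have E4 : Q y (j x) (j x) y = Q x (j y) (j y) x.
    by rewrite -curvature_j1 jj curvatureN2 Q12 opprK E3.
  by rewrite E1 E2 E3 E4; lra.
have := Qb x (j x) (j y) y.
have : Q (j x) (j y) x y = - Q x y y x by rewrite curvature_j1 Q34.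
have : Q (j y) x (j x) y = - Q x (j y) (j y) x.
  by rewrite Q12 -Qj jj curvatureN3 Q34 opprK.
by move: CA; lra.
Qed.

End CurvatureLike.

Section CurvatureSymmetries.
Context {R : realType} {n : nat} {W : set 'rV[R]_n} {G : 'rV[R]_n -> 'M[R]_n}.
Hypothesis GW : metric_patch W G.

Let oW : open W. Proof. by case: GW. Qed.

Lemma curvature_swap x u v w : curvature G x u v w = - curvature G x v u w.
Proof.
refine (etrans (curvatureE _ _ _ _) _).
refine (etrans _ (congr1 -%R (esym (curvatureE _ _ _ _)))).
by rewrite opprB.
Qed.

(** Symmetry of the Christoffel symbols makes the twelve terms of the cyclic sum cancel in pairs. *)
Lemma curvature_bianchi x u v w : W x ->
  curvature G x u v w + curvature G x v w u + curvature G x w u v = 0.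
Proof.
move=> Wx.
have dS a b c : 'D_a (fun x => christ G x b c) x = 'D_a (fun x => christ G x c b) x.
  apply: derive_eq_on oW Wx _ => y Wy; exact (patch_christ_sym GW _ _ Wy).
have cS a b c : christ G x a (christ G x b c) = christ G x a (christ G x c b).
  exact (congr1 _ (patch_christ_sym GW _ _ Wx)).
have alg (a a' b b' c c' p p' q q' r r' : 'rV[R]_n) :
    a = a' -> b = b' -> c = c' -> p = p' -> q = q' -> r = r' ->
    (a + p - (b + q)) + (b' + q' - (c' + r')) + (c + r - (a' + p')) = 0.
  by move=> -> -> -> -> -> ->; apply/rowP => k; rewrite !mxE; ring.
refine (etrans (congr2 +%R (congr2 +%R (curvatureE _ _ _ _) (curvatureE _ _ _ _))
  (curvatureE _ _ _ _)) _).
exact: (alg _ _ _ _ _ _ _ _ _ _ _ _ (dS u v w) (dS v u w) (dS w u v)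
  (cS u v w) (cS v u w) (cS w u v)).
Qed.

Local Notation D := (cov (G := G) (F := id)).

(** Second derivatives of the function <w, z>, with [w] and [z] constant, commute. Expanded by
    metric compatibility, their difference has symmetric cross terms, and what is left is <R(u,v)w,
    z> + <w, R(u,v)z> = 0. *)
Lemma curvature_skew x u v w z : W x ->
  inner (G x) (curvature G x u v w) z = - inner (G x) (curvature G x u v z) w.
Proof.
move=> Wx.
(* The pullback along the identity is the connection itself, so the rules for fields along a map
   apply. *)
have s_id : smooth_on W (id : 'rV[R]_n -> 'rV[R]_n).
  case=> [|k]; first by move=> y _; exact: cvg_id.
  split=> [y _|a]; first exact: ex_diff.
  apply: (Ck_on_ext oW (f := cst a)); last exact: Ck_on_cst.
  by move=> y _; rewrite derive_id.
have FW y : W y -> W (id y) by [].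
have sc (a : 'rV[R]_n) : smooth_on W (cst a) by exact: smooth_on_cst.
have scov b (X : 'rV[R]_n -> 'rV[R]_n) : smooth_on W X -> smooth_on W (D b X).
  by move=> sX; exact: (smooth_on_cov GW oW s_id FW).
have cm y b X Y := @cov_metric _ _ _ _ _ _ _ GW s_id FW b X Y y.
have D2 a b : 'D_a ('D_b (fun y => inner (G y) w z)) x =
    inner (G x) (D a (D b (cst w)) x) z
    + inner (G x) (D b (cst w) x) (D a (cst z) x)
    + (inner (G x) (D a (cst w) x) (D b (cst z) x)
    + inner (G x) w (D a (D b (cst z)) x)).
  rewrite (derive_eq_on (g := fun y => inner (G y) (D b (cst w) y) z +
     inner (G y) w (D b (cst z) y)) _ oW Wx); last first.
    by move=> y Wy; exact: (cm y b (cst w) (cst z) Wy (sc w) (sc z)).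
  have sI X Y : smooth_on W X -> smooth_on W Y ->
      derivable (fun y => inner (G y) (X y) (Y y)) x a.
    move=> sX sY; apply: diff_derivable; apply: (smooth_on_diff (U := W)) => //.
    by apply: smooth_on_inner => //; case: GW.
  rewrite deriveD; last 2 first.
  - exact: (sI _ (cst z) (scov _ _ (sc w)) (sc z)).
  - exact: (sI (cst w) _ (sc w) (scov _ _ (sc z))).
  refine (congr2 +%R _ _).
  - exact: (cm x a _ (cst z) Wx (scov _ _ (sc w)) (sc z)).
  - exact: (cm x a (cst w) _ Wx (sc w) (scov _ _ (sc z))).
have sG : smooth_on W (fun y => inner (G y) w z).
  by have [_ sGW _ _] := GW; exact: (smooth_on_inner oW sGW (sc w) (sc z)).
have Rc a := @cov_curvature _ _ _ _ _ _ _ GW oW s_id FW u v (cst a) x Wx (sc a).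
have Rc' a : D u (D v (cst a)) x
    - D v (D u (cst a)) x = curvature G x u v a.
  refine (etrans (Rc a) _).
  exact: (congr2 (fun p q => curvature G x p q a) (derive_id _ _) (derive_id _ _)).
rewrite (innerC (curvature G x u v z) w (patch_sym GW Wx)).
rewrite -!Rc' innerBl innerBr.
have alg (p q r s p' s' : R) : p + q + (r + s) = p' + r + (q + s') ->
  p - p' = - (s - s') by lra.
refine (alg _ _ _ _ _ _ (etrans (esym (D2 u v)) (etrans _ (D2 v u)))).
exact: schwarz_real oW Wx (sG 2).
Qed.

End CurvatureSymmetries.

(** * Kähler metrics of constant holomorphic curvature *)

Section KahlerPatch.
Context {R : realType} {m : nat} {W : set 'rV[R]_(m + m)}.
Context {G : 'rV[R]_(m + m) -> 'M[R]_(m + m)}.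
Implicit Types x u v w z : 'rV[R]_(m + m).

Lemma JD u v : J (u + v) = J u + J v :> 'rV[R]_(m + m).
Proof. by rewrite /J mulmxDl. Qed.
Lemma JN u : J (- u) = - J u :> 'rV[R]_(m + m).
Proof. by rewrite /J mulNmx. Qed.
Lemma JZ a u : J (a *: u) = a *: J u :> 'rV[R]_(m + m).
Proof. by rewrite /J -scalemxAl. Qed.

Definition kahler_patch := [/\ metric_patch W G,
  (forall x u v, W x -> inner (G x) (J u) (J v) = inner (G x) u v) &
  (forall x u v, W x -> christ G x u (J v) = J (christ G x u v))].

Hypothesis KW : kahler_patch.

Let GW : metric_patch W G. Proof. by case: KW. Qed.
Let oW : open W. Proof. by case: GW. Qed.

Lemma inner_JJ x u v : W x -> inner (G x) (J u) (J v) = inner (G x) u v.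
Proof. by case: KW => _ + _; apply. Qed.

Lemma inner_JN x u v : W x -> inner (G x) (J u) v = - inner (G x) u (J v).
Proof. by move=> Wx; rewrite -(inner_JJ _ _ Wx) JK innerNl. Qed.

Lemma inner_J_self x u : W x -> inner (G x) (J u) u = 0.
Proof.
move=> Wx; have := inner_JN u u Wx.
rewrite (innerC u (J u) (patch_sym GW Wx)); lra.
Qed.

Lemma derive_J p (X : 'rV[R]_p -> 'rV[R]_(m + m)) (u y : 'rV[R]_p) : differentiable X y ->
  'D_u (fun y => J (X y)) y = J ('D_u X y).
Proof.
move=> dX; have d0 : 'D_u (cst (Jmx m : 'M[R]_(m + m))) y = 0 by exact: derive_cst.
have := derive_mulmx u dX (differentiable_cst (Jmx m : 'M[R]_(m + m)) y).
by rewrite d0 mulmx0 addr0.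
Qed.

Lemma curvature_J x u v w : W x -> curvature G x u v (J w) = J (curvature G x u v w).
Proof.
move=> Wx; have cJ y a b : W y -> christ G y a (J b) = J (christ G y a b).
  by case: KW => _ _; apply.
have dJ a b : 'D_a (fun x => christ G x b (J w)) x = J ('D_a (fun x => christ G x b w) x).
  refine (etrans _ (derive_J a (differentiable_christ b w GW Wx))).
  by apply: derive_eq_on oW Wx _ => y Wy; exact: cJ.
have cc a b : christ G x a (christ G x b (J w)) = J (christ G x a (christ G x b w)).
  by rewrite (cJ x b w Wx) cJ.
refine (etrans (curvatureE _ _ _ _) _).
refine (etrans _ (congr1 _ (esym (curvatureE _ _ _ _)))).
have alg (p q r s p' q' r' s' : 'rV[R]_(m + m)) :
  p' = J p -> q' = J q -> r' = J r -> s' = J s ->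
  p' + q' - (r' + s') = J (p + q - (r + s)) by move=> -> -> -> ->; rewrite JD JN !JD.
exact: (alg _ _ _ _ _ _ _ _ (dJ u v) (cc u v) (dJ v u) (cc v u)).
Qed.

Lemma cov_J p (V : set 'rV[R]_p) (F X : 'rV[R]_p -> 'rV[R]_(m + m)) (u y : 'rV[R]_p) :
  (forall y, V y -> W (F y)) -> V y -> smooth_on V X ->
  cov (G := G) (F := F) u (fun t => J (X t)) y = J (cov (G := G) (F := F) u X y).
Proof.
move=> FW Vy sX; case: KW => _ _ cJ.
refine (etrans (congr2 +%R (derive_J u (smooth_on_diff sX Vy)) (cJ _ _ _ (FW y Vy))) _).
exact: (esym (JD _ _)).
Qed.

Variable c : R.
Hypothesis Kc : forall x u, W x -> u != 0 -> sectional G x u (J u) = 4 * c.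

(* The curvature tensor of the complex space form of holomorphic curvature 4. *)
Definition space_form_tensor (A : 'M[R]_(m + m)) u v w z : R := let g := inner A in
  g v w * g u z - g u w * g v z + g (J v) w * g (J u) z - g (J u) w * g (J v) z
  + 2 * g u (J v) * g (J w) z.

(** The difference [Q] of the two sides has all the symmetries of a Kähler curvature tensor and
    vanishes on (u, Ju, Ju, u), so [holomorphic0_curvature0] makes it zero. Writing the model tensor
    with the skew form [o] reduces each symmetry to a polynomial identity. *)
Lemma space_form_curvature x u v w z : W x ->
  inner (G x) (curvature G x u v w) z = c * space_form_tensor (G x) u v w z.
Proof.
move=> Wx; apply/eqP; rewrite -subr_eq0; apply/eqP; move: u v w z.
pose Q u v w z :=
  inner (G x) (curvature G x u v w) z - c * space_form_tensor (G x) u v w z.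
pose g := inner (G x); pose o u v := inner (G x) u (J v).
have gC u v : g u v = g v u by apply: innerC; exact: patch_sym GW _ Wx.
have oN u v : o u v = - o v u by rewrite /o -(inner_JN _ _ Wx); exact: gC.
have oJ u v : o u (J v) = - g u v by rewrite /o JK innerNr.
have oJJ u v : o (J u) (J v) = o u v by exact: inner_JJ.
have gJJ u v : g (J u) (J v) = g u v by exact: inner_JJ.
have R0E a b d e : space_form_tensor (G x) a b d e =
    g b d * g a e - g a d * g b e + o b d * o a e - o a d * o b e - 2 * o a b * o d e.
  by rewrite /space_form_tensor /g /o !(inner_JN _ _ Wx); ring.
have H1 a b d e : Q a b d e = - Q b a d e.
  by rewrite /Q curvature_swap innerNl !R0E (oN b a); ring.
have H2 a b d e : Q a b d e = - Q a b e d.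
  by rewrite /Q (curvature_skew GW _ _ _ _ Wx) !R0E (oN e d); ring.
have H3 a b d e : Q a b d e + Q b d a e + Q d a b e = 0.
  have alg (p q r k y z t : R) : p + q + r = 0 -> y + z + t = 0 ->
      p - k * y + (q - k * z) + (r - k * t) = 0.
    move=> h1 h2; transitivity ((p + q + r) - k * (y + z + t)); first by ring.
    by rewrite h1 h2 mulr0 subr0.
  apply: alg.
    by rewrite -!innerDl (curvature_bianchi GW _ _ _ Wx) inner0l.
  by rewrite !R0E (gC d a) (gC d b) (gC b a) (oN d a) (oN d b) (oN b a); ring.
have H4 a b d e e' : Q a b d (e + e') = Q a b d e + Q a b d e'.
  by rewrite /Q /space_form_tensor !innerDr; ring.
have H5 a b d e : Q a b (J d) (J e) = Q a b d e.
  rewrite /Q curvature_J // inner_JJ // !R0E !oJJ.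
  have gJr p q : g p (J q) = o p q by [].
  by rewrite !gJr !oJ; ring.
have jj (u : 'rV[R]_(m + m)) : J (J u) = - u by exact: JK.
apply: (holomorphic0_curvature0 H1 H2 H3 H4 JD jj H5) => u.
(* At [u = 0] the quotient [sectional] carries no information, and [Q] vanishes directly. *)
have [->|u0] := eqVneq u 0.
  have Z a b d : Q a b d 0 = 0.
    by rewrite /Q /space_form_tensor !inner0r !(mulr0, mul0r, subr0, addr0).
  exact: Z.
have gp : 0 < g u u by case: GW => _ _ _ /(_ _ Wx); apply.
have ou : o u u = 0 by have := oN u u; lra.
have := Kc Wx u0; rewrite /sectional inner_JJ // -/(g u u) -/(o u u) ou expr0n subr0.
move=> /(canRL (divfK _)) => K; rewrite /Q K; last by rewrite mulf_neq0 ?gt_eqF.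
have e1 : o (J u) u = g u u by exact: gJJ.
have e2 : g u (J u) = 0 by exact: ou.
by rewrite R0E gJJ oJJ oJ e1 e2 ou; ring.
Qed.

End KahlerPatch.

(** * Rigidity of the equality case *)

Section EigenCancellation.
Context {R : realType}.

(** The algebra of [Qt] below: [rho] is |tau|^2, [P] and [Q] are the components of a tangent vector
    along [tau] and [J tau], and [r], [t] those of the derivative of [tau]. The curvature term is
    absorbed by the J xi components and the [P r] products cancel, whereas the [Q t] products
    double. *)
Lemma cancel_eigen (l rho fvu fuv avu auv ev eu Pu Pv Qu Qv ru rv tu tv : R) :
  - l * (fvu - fuv) - (avu - auv) = - l ^+ 2 * (ev * Qu - eu * Qv) ->
  rho * fvu = rho * (l * ev * Qu) + Pv * ru + Qv * tu ->
  rho * fuv = rho * (l * eu * Qv) + Pu * rv + Qu * tv ->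
  rho * avu = - l * Pv * ru + l * Qv * tu ->
  rho * auv = - l * Pu * rv + l * Qu * tv ->
  2 * l * (Qu * tv) = 2 * l * (Qv * tu).
Proof.
move=> /(congr1 ( *%R rho)) K /(congr1 ( *%R l)) f1 /(congr1 ( *%R l)) f2 a1 a2; lra.
Qed.

Lemma cancel_eigenJ (l rho fvu fuv avu auv ev eu Pu Pv Qu Qv ru rv tu tv : R) :
  l * (fvu - fuv) - (avu - auv) = l ^+ 2 * (ev * Pu - eu * Pv) ->
  rho * fvu = rho * (l * ev * Pu) - Pv * tu + Qv * ru ->
  rho * fuv = rho * (l * eu * Pv) - Pu * tv + Qu * rv ->
  rho * avu = l * Pv * tu + l * Qv * ru ->
  rho * auv = l * Pu * tv + l * Qu * rv ->
  2 * l * (Pu * tv) = 2 * l * (Pv * tu).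
Proof.
move=> /(congr1 ( *%R rho)) K /(congr1 ( *%R l)) f1 /(congr1 ( *%R l)) f2 a1 a2; lra.
Qed.

End EigenCancellation.

Section Rigidity.
Context {R : realType} {p m : nat}.
Local Notation T := 'rV[R]_p.
Local Notation E := 'rV[R]_(m + m).
Local Notation J := (@J R m).
(** [dF u] is the image of the constant field [u] and [D] the pullback connection, so [D u xi] is
    minus the shape operator applied to [u]. The connection enters only through the rules listed
    below, which keeps Christoffel symbols out of the argument. *)
Variables (V : set T) (G : T -> 'M[R]_(m + m)) (dF : T -> T -> E) (xi : T -> E).
Variables (d : T -> (T -> R) -> T -> R) (D : T -> (T -> E) -> T -> E) (c : R).
Local Notation "<< X , Y >>_ y" := (inner (G y) X Y)
  (at level 0, X at level 200, Y at level 200, y at level 0).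

Hypotheses (oV : open V) (sG : smooth_on V G) (sdF : forall u, smooth_on V (dF u))
  (sxi : smooth_on V xi) (sD : forall u X, smooth_on V X -> smooth_on V (D u X)).
Hypotheses
  (d_eq : forall u f h y, V y -> (forall z, V z -> f z = h z) -> d u f y = d u h y)
  (d_cst : forall u k y, d u (fun=> k) y = 0)
  (dZ : forall u (k : R) (f : T -> R) y, V y -> smooth_on V f ->
     d u (fun z => k * f z) y = k * d u f y)
  (D_metric : forall u X Y y, V y -> smooth_on V X -> smooth_on V Y ->
     d u (fun z => <<X z, Y z>>_z) y = <<D u X y, Y y>>_y + <<X y, D u Y y>>_y)
  (D_J : forall u X y, V y -> smooth_on V X ->
     D u (fun z => J (X z)) y = J (D u X y))
  (D_torsion : forall u v y, V y -> D u (dF v) y = D v (dF u) y)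
  (D_curvature : forall u v X Z y, V y -> smooth_on V X ->
     <<D u (D v X) y - D v (D u X) y, Z>>_y =
     c * space_form_tensor (G y) (dF u y) (dF v y) (X y) Z).
(* [parseval] is stated for [e] of arbitrary norm, possibly 0; it says that the ambient
   complex dimension is 2. *)
Hypotheses
  (gC : forall y X Y, V y -> <<X, Y>>_y = <<Y, X>>_y)
  (gp : forall y, V y -> posdef (G y))
  (gJ : forall y X Y, V y -> <<J X, Y>>_y = - <<X, J Y>>_y)
  (xi1 : forall y, V y -> <<xi y, xi y>>_y = 1)
  (xi_normal : forall u y, V y -> <<dF u y, xi y>>_y = 0)
  (tangent : forall y X, V y -> <<X, xi y>>_y = 0 -> exists u, dF u y = X)
  (parseval : forall y e X Y, V y -> <<e, xi y>>_y = 0 -> <<e, J (xi y)>>_y = 0 ->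
     <<e, e>>_y * <<X, Y>>_y =
     <<e, e>>_y * (<<X, xi y>>_y * <<Y, xi y>>_y + <<X, J (xi y)>>_y * <<Y, J (xi y)>>_y)
     + <<X, e>>_y * <<Y, e>>_y + <<X, J e>>_y * <<Y, J e>>_y)
  (frame : forall y, V y -> exists u v, dF v y = J (dF u y) /\ <<dF u y, dF u y>>_y = 1).

Let gJJ y X Y : V y -> <<J X, J Y>>_y = <<X, Y>>_y.
Proof. by move=> Vy; rewrite gJ // JK innerNr opprK. Qed.

Let gXJX y X : V y -> <<X, J X>>_y = 0.
Proof. by move=> Vy; have := gJ X X Vy; rewrite (gC _ _ Vy); lra. Qed.

Let d_0 u f y : V y -> (forall z, V z -> f z = 0) -> d u f y = 0.
Proof. by move=> Vy f0; rewrite (d_eq u Vy f0) d_cst. Qed.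

Let sJ X : smooth_on V X -> smooth_on V (fun z => J (X z)).
Proof. by move=> sX; apply: smooth_on_mulmx => //; exact: smooth_on_cst. Qed.

Let xiJ y : V y -> <<xi y, J (xi y)>>_y = 0.
Proof. exact: gXJX. Qed.

Let Dxi_xi u y : V y -> <<D u xi y, xi y>>_y = 0.
Proof.
move=> Vy; have := D_metric u Vy sxi sxi.
rewrite (d_eq u Vy (h := fun=> 1)) // d_cst (gC _ _ Vy); lra.
Qed.

Let dF_Dxi u v y : V y -> <<D u (dF v) y, xi y>>_y = - <<D u xi y, dF v y>>_y.
Proof.
move=> Vy; have := D_metric u Vy (sdF v) sxi.
by rewrite (d_0 _ Vy (fun z Vz => xi_normal v Vz)) (gC (dF v y) _ Vy); lra.
Qed.

(** Symmetry of the shape operator, a consequence of torsion-freeness. *)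
Let hC u v y : V y -> <<D u xi y, dF v y>>_y = <<D v xi y, dF u y>>_y.
Proof.
move=> Vy; have := dF_Dxi u v Vy; have := dF_Dxi v u Vy.
rewrite (D_torsion u v Vy); lra.
Qed.

Hypotheses
  (A_Jxi : forall u y, V y -> <<D u xi y, J (xi y)>>_y = 0)
  (A_trace : forall u v y, V y -> dF v y = J (dF u y) ->
     <<D u xi y, dF u y>>_y + <<D v xi y, dF v y>>_y = 0).

Let gJx X Y y : V y -> <<X, J Y>>_y = - <<Y, J X>>_y.
Proof. by move=> Vy; rewrite -(gJ _ _ Vy) gC. Qed.

(** Codazzi along J xi. Differentiating <D v xi, J xi> = 0 turns the second derivatives of [xi] into
    products of first ones. On the curvature side only the last term of the model tensor survives,
    and its factor 2 matches the two equal terms on the left. *)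
Let A_square_J u v y : V y -> <<D u xi y, J (D v xi y)>>_y = c * <<dF u y, J (dF v y)>>_y.
Proof.
move=> Vy.
have H a b : <<D a (D b xi) y, J (xi y)>>_y = - <<D b xi y, J (D a xi y)>>_y.
  have := D_metric a Vy (sD b sxi) (sJ sxi).
  rewrite (d_0 _ Vy (fun z Vz => A_Jxi b Vz)) (D_J _ Vy sxi); lra.
have := D_curvature u v (J (xi y)) Vy sxi; rewrite innerBl !H /space_form_tensor.
rewrite (gJx (D v xi y)) // !gJJ // xi1 // !xi_normal //; lra.
Qed.

Let normal_frame u v y : V y -> dF v y = J (dF u y) ->
  <<dF u y, J (xi y)>>_y = 0.
Proof. by move=> Vy E1; have := gJ (dF u y) (xi y) Vy; rewrite -E1 xi_normal //; lra. Qed.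

(* A symmetric trace-free operator on the plane spanned by [e] and [Je] has a matrix
   of the form [[a, b], [b, -a]]. *)
Let adapted_frame y : V y -> exists e a b,
  [/\ <<e, xi y>>_y = 0, <<e, J (xi y)>>_y = 0, <<e, e>>_y = 1,
    forall v, <<D v xi y, e>>_y = a * <<dF v y, e>>_y + b * <<dF v y, J e>>_y &
    forall v, <<D v xi y, J e>>_y = b * <<dF v y, e>>_y - a * <<dF v y, J e>>_y].
Proof.
move=> Vy; have [u [w [wE e1]]] := frame Vy.
have e_xi := xi_normal u Vy; have e_Jxi := normal_frame Vy wE.
have P := parseval _ _ Vy e_xi e_Jxi.
exists (dF u y), <<D u xi y, dF u y>>_y, <<D u xi y, J (dF u y)>>_y; split=> // v.
  rewrite (hC v u Vy); have := P (D u xi y) (dF v y).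
  by rewrite e1 Dxi_xi // A_Jxi // !mul1r => ->; ring.
have tr := A_trace Vy wE.
have := P (D w xi y) (dF v y); rewrite -wE (hC v w Vy) (hC w u Vy).
rewrite e1 Dxi_xi // A_Jxi // !mul1r => ->.
have -> : <<D w xi y, dF w y>>_y = - <<D u xi y, dF u y>>_y by lra.
ring.
Qed.

(** [A_square_J] evaluated on the tangent vectors with images [e] and [J e], where the matrix of A
    has determinant - (a^2 + b^2). *)
Let A_square y : V y -> exists e a b,
  [/\ <<e, xi y>>_y = 0 /\ <<e, J (xi y)>>_y = 0, <<e, e>>_y = 1,
    forall v, <<D v xi y, e>>_y = a * <<dF v y, e>>_y + b * <<dF v y, J e>>_y,
    forall v, <<D v xi y, J e>>_y = b * <<dF v y, e>>_y - a * <<dF v y, J e>>_y &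
    a ^+ 2 + b ^+ 2 = - c].
Proof.
move=> Vy; have [e [a [b [e_xi e_Jxi e1 He HJe]]]] := adapted_frame Vy.
exists e, a, b; split=> //.
have [u uE] := tangent Vy e_xi.
have Je_xi : <<J e, xi y>>_y = 0 by rewrite gJ // e_Jxi oppr0.
have [w wE] := tangent Vy Je_xi.
have := A_square_J u w Vy; have := parseval (D u xi y) (J (D w xi y)) Vy e_xi e_Jxi.
rewrite e1 !mul1r => ->; rewrite Dxi_xi // A_Jxi // uE wE JK innerNr e1.
rewrite !gJJ // (gJ (D w xi y) e) // !He !HJe uE wE e1 gXJX // gJJ // e1.
rewrite (gC (J e)) // gXJX //; lra.
Qed.

Let A_eq0 u v y : c = 0 -> V y -> <<D u xi y, dF v y>>_y = 0.
Proof.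
move=> c0 Vy; have [e [a [b [[e_xi e_Jxi] e1 He HJe ab]]]] := A_square Vy.
have [a0 b0] : a = 0 /\ b = 0.
  move/eqP: ab; rewrite c0 oppr0 paddr_eq0 ?sqr_ge0 // !sqrf_eq0.
  by move=> /andP[/eqP -> /eqP ->].
have := parseval (D u xi y) (dF v y) Vy e_xi e_Jxi.
rewrite e1 !mul1r => ->; rewrite Dxi_xi // A_Jxi // He HJe a0 b0; ring.
Qed.

Let DxiDxi u v y : V y -> <<D u xi y, D v xi y>>_y =
  - c * (<<dF u y, dF v y>>_y - <<dF u y, J (xi y)>>_y * <<dF v y, J (xi y)>>_y).
Proof.
move=> Vy; have [e [a [b [[e_xi e_Jxi] e1 He HJe <-]]]] := A_square Vy.
have P X Y := parseval X Y Vy e_xi e_Jxi.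
have := P (D u xi y) (D v xi y); rewrite e1 !mul1r => ->.
have := P (dF u y) (dF v y); rewrite e1 !mul1r => ->.
rewrite !Dxi_xi // !A_Jxi // !xi_normal // !He !HJe; ring.
Qed.

(** The anticommutation of A and J on D, written as the symmetry of a bilinear form. *)
Let DxiJ u v y : V y -> <<D u xi y, J (dF v y)>>_y = <<D v xi y, J (dF u y)>>_y.
Proof.
move=> Vy; have [e [a [b [[e_xi e_Jxi] e1 He HJe _]]]] := A_square Vy.
have P X Y := parseval X Y Vy e_xi e_Jxi.
have := P (D u xi y) (J (dF v y)); rewrite e1 !mul1r => ->.
have := P (D v xi y) (J (dF u y)); rewrite e1 !mul1r => ->.
rewrite !Dxi_xi // !A_Jxi // !gJJ // !(gJ _ e) // !He !HJe; ring.
Qed.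

Section Eigenfield.
Variables (l : R) (u0 : T).
Hypotheses (lc : l ^+ 2 = - c) (l0 : l != 0).

(* Since [A^2 = l^2] on the holomorphic plane, [l e + A e] is an eigenvector of [A]
   for every [e] in it; [D u xi] is [- A u]. *)
Let tau z := l *: (dF u0 z - <<dF u0 z, J (xi z)>>_z *: J (xi z)) - D u0 xi z.

Let stau : smooth_on V tau.
Proof.
apply: smooth_onB => //; last exact: sD.
apply: smooth_onZ => //; apply: smooth_onB => //.
by apply: smooth_on_scale; [|apply: smooth_on_inner|]; rewrite //; exact: sJ.
Qed.

Let tau_xi y : V y -> <<tau y, xi y>>_y = 0.
Proof.
move=> Vy; rewrite /tau !(innerBl, innerZl) Dxi_xi // xi_normal // (gJ (xi y)) // xiJ //.
ring.
Qed.

Let tau_Jxi y : V y -> <<tau y, J (xi y)>>_y = 0.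
Proof.
move=> Vy; rewrite /tau !(innerBl, innerZl) A_Jxi // gJJ // xi1 //; ring.
Qed.

Let tau_eigen v y : V y -> <<D v xi y, tau y>>_y = - l * <<dF v y, tau y>>_y.
Proof.
move=> Vy; rewrite /tau !(innerBr, innerZr) A_Jxi // (hC v u0 Vy) DxiDxi // -lc.
rewrite (gC (dF v y) (D u0 xi y)) //; ring.
Qed.

Let tau_eigenJ v y : V y -> <<D v xi y, J (tau y)>>_y = l * <<dF v y, J (tau y)>>_y.
Proof.
have JB X Y : J (X - Y) = J X - J Y by rewrite JD JN.
move=> Vy; rewrite /tau !(JB, JZ) JK !(innerBr, innerZr, innerNr).
rewrite A_square_J // (DxiJ v u0) // xi_normal // Dxi_xi //.
rewrite (gJx (dF v y) (D u0 xi y)) //.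
have -> : c = - l ^+ 2 by rewrite lc opprK.
ring.
Qed.

Local Notation P u y := <<dF u y, tau y>>_y.
Local Notation Q u y := <<dF u y, J (tau y)>>_y.
(* [t] measures the rotation of the eigenframe [tau, J tau]. *)
Local Notation t u y := <<D u tau y, J (tau y)>>_y.

Let Dtau_xi v y : V y -> <<D v tau y, xi y>>_y = l * P v y.
Proof.
move=> Vy; have := D_metric v Vy stau sxi; rewrite (d_0 _ Vy tau_xi).
rewrite (gC (tau y)) // tau_eigen //; lra.
Qed.

Let Dtau_Jxi v y : V y -> <<D v tau y, J (xi y)>>_y = l * Q v y.
Proof.
move=> Vy; have := D_metric v Vy stau (sJ sxi); rewrite (d_0 _ Vy tau_Jxi).
by rewrite (D_J _ Vy sxi) (gJx (tau y)) // tau_eigenJ //; lra.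
Qed.

Let tau_parseval X Y y (Vy : V y) := parseval X Y Vy (tau_xi Vy) (tau_Jxi Vy).

(** The [tau] component of the Codazzi equation. Differentiating [tau_eigen] replaces second
    derivatives of [xi] by first derivatives of [tau], and torsion-freeness removes the derivatives
    of [dF]. [Pt] is the [J tau] component, treated in the same way. *)
Let Qt u v y : V y -> Q u y * t v y = Q v y * t u y.
Proof.
move=> Vy.
have H a b : <<D a (D b xi) y, tau y>>_y =
    - l * (<<D a (dF b) y, tau y>>_y + <<dF b y, D a tau y>>_y)
    - <<D b xi y, D a tau y>>_y.
  have := D_metric a Vy (sD b sxi) stau.
  have sP : smooth_on V (fun z => P b z) by exact: smooth_on_inner.
  rewrite (d_eq a Vy (tau_eigen b)) (dZ a (- l) Vy sP) (D_metric a Vy (sdF b) stau); lra.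
have K : - l * (<<dF v y, D u tau y>>_y - <<dF u y, D v tau y>>_y)
    - (<<D v xi y, D u tau y>>_y - <<D u xi y, D v tau y>>_y) =
    - l ^+ 2 * (<<dF v y, J (xi y)>>_y * Q u y - <<dF u y, J (xi y)>>_y * Q v y).
  have := D_curvature u v (tau y) Vy sxi.
  rewrite innerBl !H (D_torsion u v Vy) /space_form_tensor.
  rewrite !(gJ (dF _ _)) // !xi_normal // (gJ (xi y)) // (gJx (xi y) (tau y)) //.
  rewrite tau_Jxi // lc.
  lra.
have p1 a b : <<tau y, tau y>>_y * <<dF a y, D b tau y>>_y =
    <<tau y, tau y>>_y * (l * <<dF a y, J (xi y)>>_y * Q b y)
    + P a y * <<D b tau y, tau y>>_y + Q a y * t b y.
  by rewrite tau_parseval // xi_normal // Dtau_Jxi //; ring.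
have p2 a b : <<tau y, tau y>>_y * <<D a xi y, D b tau y>>_y =
    - l * P a y * <<D b tau y, tau y>>_y + l * Q a y * t b y.
  by rewrite tau_parseval // Dxi_xi // A_Jxi // tau_eigen // tau_eigenJ //; ring.
have l20 : 2 * l != 0 by rewrite mulf_neq0 // pnatr_eq0.
apply: (mulfI l20).
exact: (cancel_eigen K (p1 v u) (p1 u v) (p2 v u) (p2 u v)).
Qed.

Let Pt u v y : V y -> P u y * t v y = P v y * t u y.
Proof.
move=> Vy.
have sJt := sJ stau.
have H a b : <<D a (D b xi) y, J (tau y)>>_y =
    l * (<<D a (dF b) y, J (tau y)>>_y + <<dF b y, J (D a tau y)>>_y)
    - <<D b xi y, J (D a tau y)>>_y.
  have := D_metric a Vy (sD b sxi) sJt.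
  have sQ : smooth_on V (fun z => Q b z) by exact: smooth_on_inner.
  rewrite (d_eq a Vy (tau_eigenJ b)) (dZ a l Vy sQ) (D_metric a Vy (sdF b) sJt).
  rewrite (D_J _ Vy stau); lra.
have K : l * (<<dF v y, J (D u tau y)>>_y - <<dF u y, J (D v tau y)>>_y)
    - (<<D v xi y, J (D u tau y)>>_y - <<D u xi y, J (D v tau y)>>_y) =
    l ^+ 2 * (<<dF v y, J (xi y)>>_y * P u y - <<dF u y, J (xi y)>>_y * P v y).
  have := D_curvature u v (J (tau y)) Vy sxi.
  rewrite innerBl !H (D_torsion u v Vy) /space_form_tensor.
  rewrite !(gJ (dF _ _) (xi y)) // !xi_normal // !gJJ // (gC (xi y)) // tau_xi // lc.
  lra.
have p1 a b : <<tau y, tau y>>_y * <<dF a y, J (D b tau y)>>_y =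
    <<tau y, tau y>>_y * (l * <<dF a y, J (xi y)>>_y * P b y)
    - P a y * t b y + Q a y * <<D b tau y, tau y>>_y.
  by rewrite tau_parseval // xi_normal // !gJJ // Dtau_xi // (gJ _ (tau y)) //; ring.
have p2 a b : <<tau y, tau y>>_y * <<D a xi y, J (D b tau y)>>_y =
    l * P a y * t b y + l * Q a y * <<D b tau y, tau y>>_y.
  rewrite tau_parseval // Dxi_xi // A_Jxi // tau_eigen // tau_eigenJ //.
  by rewrite !gJJ // (gJ _ (tau y)) //; ring.
have l20 : 2 * l != 0 by rewrite mulf_neq0 // pnatr_eq0.
apply: (mulfI l20).
exact: (cancel_eigenJ K (p1 v u) (p1 u v) (p2 v u) (p2 u v)).
Qed.

Let tau_frame y : V y -> exists u v, dF u y = tau y /\ dF v y = J (tau y).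
Proof.
move=> Vy; have [u uE] := tangent Vy (tau_xi Vy).
have Jt : <<J (tau y), xi y>>_y = 0 by rewrite gJ // tau_Jxi // oppr0.
by have [v vE] := tangent Vy Jt; exists u, v.
Qed.

(** Where [tau] is nonzero, let [u1], [v1] have images [tau], [J tau]. Then [Q u1] is 0 and [Q v1]
    is |tau|^2, so [Qt] gives [t u1 = 0]; now [Pt] on [u1] and [u] gives |tau|^2 [t u] = 0. *)
Let tau_t u y : V y -> t u y = 0.
Proof.
move=> Vy; have [tau0|tau0] := eqVneq (tau y) 0.
  by rewrite tau0 -(scale0r 0) JZ scale0r inner0r.
have rho0 : <<tau y, tau y>>_y != 0 by rewrite gt_eqF // gp.
have [u1 [v1 [u1E v1E]]] := tau_frame Vy.
have t1 : t u1 y = 0.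
  have := Qt u1 v1 Vy; rewrite u1E v1E gXJX // gJJ // mul0r => /esym/eqP.
  by rewrite mulf_eq0 (negPf rho0) => /eqP.
have := Pt u1 u Vy; rewrite u1E t1 mulr0 => /eqP.
by rewrite mulf_eq0 (negPf rho0) => /eqP.
Qed.

(* As [t] vanishes, the curvature in the direction [tau, J tau] comes only from the
   normal components of [D tau]; this gives [2 c |tau|^4 = - 4 c |tau|^4]. *)
Let tau_eq0 y : V y -> tau y = 0.
Proof.
move=> Vy; have [//|tau0] := eqVneq (tau y) 0.
have rho0 : <<tau y, tau y>>_y != 0 by rewrite gt_eqF // gp.
have [u [v [uE vE]]] := tau_frame Vy.
have H a b : <<D a (D b tau) y, J (tau y)>>_y = - <<D b tau y, J (D a tau y)>>_y.
  have := D_metric a Vy (sD b stau) (sJ stau).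
  rewrite (d_0 _ Vy (fun z Vz => tau_t b Vz)) (D_J _ Vy stau); lra.
have K : <<D u tau y, J (D v tau y)>>_y = - l ^+ 2 * <<tau y, tau y>>_y ^+ 2.
  apply: (mulfI rho0); rewrite tau_parseval // !gJJ // !(gJ (D v tau y)) //.
  by rewrite !Dtau_xi // !Dtau_Jxi // !tau_t // uE vE gJJ // gXJX //; ring.
have := D_curvature u v (J (tau y)) Vy stau.
rewrite innerBl !H (gJx (D v tau y)) // K uE vE /space_form_tensor JK.
rewrite !(innerNr, innerNl) !gJJ // (gJ (tau y)) // gXJX // -[c]opprK -lc => E0.
have : (l * <<tau y, tau y>>_y) ^+ 2 = 0 by rewrite exprMn; lra.
by move=> /eqP; rewrite sqrf_eq0 mulf_eq0 (negPf l0) (negPf rho0).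
Qed.

Lemma eigenfield_eq0 y : V y ->
  l *: (dF u0 y - <<dF u0 y, J (xi y)>>_y *: J (xi y)) = D u0 xi y.
Proof. by move=> /tau_eq0 /eqP; rewrite subr_eq0 => /eqP. Qed.

End Eigenfield.

Lemma rigidity y : V y -> c = 0 /\ forall u v, <<D u xi y, dF v y>>_y = 0.
Proof.
move=> Vy; suff c0 : c = 0 by split=> // u v; exact: A_eq0.
have [e [a [b [[e_xi e_Jxi] e1 He HJe ab]]]] := A_square Vy.
apply/eqP/negPn/negP => c0.
have c_gt0 : 0 < - c by rewrite lt_def oppr_eq0 c0 -ab addr_ge0 // sqr_ge0.
pose l := Num.sqrt (- c).
have lc : l ^+ 2 = - c by rewrite sqr_sqrtr // ltW.
have l_gt0 : 0 < l by rewrite sqrtr_gt0.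
have l0 : l != 0 by rewrite gt_eqF.
have [u uE] := tangent Vy e_xi.
have Je_xi : <<J e, xi y>>_y = 0 by rewrite gJ // e_Jxi oppr0.
have [w wE] := tangent Vy Je_xi.
(* By [eigenfield_eq0], [D xi] acts on the holomorphic plane as multiplication by [l], whereas [He]
   and [HJe] give it the diagonal entries [a] and [- a]. Hence [l = a = - a], against [0 < l]. *)
have := congr1 (fun X => <<X, e>>_y) (eigenfield_eq0 u lc l0 Vy).
have := congr1 (fun X => <<X, J e>>_y) (eigenfield_eq0 w lc l0 Vy).
rewrite /= He HJe uE wE !(innerZl, innerBl) !gJJ // e_Jxi e_xi e1 gXJX //.
by rewrite (gJ e e) // gXJX // (gC (xi y)) // e_xi; lra.
Qed.

End Rigidity.

(** * The Gauss equation *)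

Section MetricRicci.
Context {R : realType} {n : nat} {W : set 'rV[R]_n} {G : 'rV[R]_n -> 'M[R]_n}.
Hypothesis GW : metric_patch W G.

Lemma patch_curvature_pair x u v w z : W x ->
  inner (G x) (curvature G x u v w) z = inner (G x) (curvature G x w z u) v.
Proof.
move=> Wx; pose Q u v w z := inner (G x) (curvature G x u v w) z.
apply: (@curvature_pair _ _ Q) => a b d e.
- by rewrite /Q curvature_swap innerNl.
- exact: (curvature_skew GW _ _ _ _ Wx).
by rewrite /Q -!innerDl (curvature_bianchi GW _ _ _ Wx) inner0l.
Qed.

Lemma ricci_frame x u v (p : 'I_n -> 'rV[R]_n) : W x ->
  (forall i j, inner (G x) (p i) (p j) = (i == j)%:R) ->
  ricci G x u v = \sum_k inner (G x) (curvature G x (p k) u v) (p k).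
Proof.
move=> Wx po; have gT := patch_sym GW Wx.
pose f k y := inner (G x) (curvature G x y u v) (p k).
(* Pair symmetry and skewness move [y] from a differentiation slot of the curvature into a slot of
   the inner product, where linearity is immediate. *)
have fE k y : f k y = inner (G x) (curvature G x v (p k) y) u.
  exact: patch_curvature_pair.
have fE' k y : f k y = - inner (G x) (curvature G x v (p k) u) y.
  by rewrite fE (curvature_skew GW _ _ _ _ Wx).
rewrite -(frame_trace_linear p (f := f)).
  by apply: eq_bigr => a _; exact: (frame_coord po).
move=> k y; rewrite fE' {1}[y]row_sum_delta inner_sumr -sumrN.
by apply: eq_bigr => a _; rewrite fE' innerZr mulrN.
Qed.

End MetricRicci.

Section Hypersurface.
Local Opaque cov.
Context {R : realType} {p n : nat} {W : set 'rV[R]_n} {G : 'rV[R]_n -> 'M[R]_n}.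
Context {V : set 'rV[R]_p} {gN : 'rV[R]_p -> 'M[R]_p} {F : 'rV[R]_p -> 'rV[R]_n}.
Context {xi : 'rV[R]_p -> 'rV[R]_n}.
Hypotheses (np : n = p.+1) (GW : metric_patch W G) (NV : metric_patch V gN)
  (sF : smooth_on V F) (FW : forall y, V y -> W (F y)).
Hypotheses (iso : forall y u v, V y ->
    inner (gN y) u v = inner (G (F y)) ('D_u F y) ('D_v F y))
  (sxi : smooth_on V xi)
  (xi1 : forall y, V y -> inner (G (F y)) (xi y) (xi y) = 1)
  (xi_normal : forall y u, V y -> inner (G (F y)) ('D_u F y) (xi y) = 0).

Local Notation D := (cov (G := G) (F := F)).
Local Notation g y := (inner (G (F y))).

Let oV : open V. Proof. by case: NV. Qed.
Let sdF u : smooth_on V ('D_u F). Proof. exact: smooth_on_derive. Qed.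
Let gC y X Y : V y -> g y X Y = g y Y X.
Proof. by move=> Vy; apply: innerC; exact (patch_sym GW (FW Vy)). Qed.
Let gp y : V y -> posdef (G (F y)).
Proof. by move=> Vy; case: GW => _ _ _; apply; exact: FW. Qed.

(** Being isometric, [F] has a Jacobian of full rank [p], and its row space is the hyperplane
    orthogonal to [xi]. *)
Lemma tangent_of_orthogonal y X : V y -> g y X (xi y) = 0 -> exists u, 'D_u F y = X.
Proof.
move=> Vy X0.
have tE u : 'D_u F y = u *m jacobian F y.
  exact: deriveEjacobian (smooth_on_diff sF Vy).
have free : row_free (jacobian F y).
  apply/inj_row_free => u u0; have [_ _ _ /(_ _ Vy) pN] := NV.
  by apply: (posdef_inner_eq0 pN); rewrite iso // tE u0 inner0l.
have /submxP[u uE] : (X <= jacobian F y)%MS.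
  apply: (orthogonal_submx np free _ _ X0); first by rewrite xi1 // oner_eq0.
  by move=> u; rewrite -tE xi_normal.
by exists u; rewrite tE.
Qed.

Lemma normal_component y X : V y -> (forall w, g y X ('D_w F y) = 0) ->
  X = g y X (xi y) *: xi y.
Proof.
move=> Vy X0; apply/eqP; rewrite -subr_eq0; apply/eqP.
set Z := X - _; have Z0 : g y Z (xi y) = 0.
  by rewrite /Z innerBl innerZl xi1 // mulr1 subrr.
have [w wE] := tangent_of_orthogonal Vy Z0.
apply: (posdef_inner_eq0 (gp Vy)); rewrite -{2}wE /Z innerBl innerZl X0.
by rewrite (gC (xi y)) // xi_normal // mulr0 subrr.
Qed.

(* Both sides satisfy the Koszul identities. *)
Lemma cov_tangential u v w y : V y ->
  g y (D u ('D_v F) y) ('D_w F y) = inner (gN y) (christ gN y u v) w.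
Proof.
move=> Vy.
pose A a b e := g y (D a ('D_b F) y) ('D_e F y).
pose B a b e := inner (gN y) (christ gN y a b) e.
have As a b e : A a b e = A b a e.
  exact: (congr1 (fun X => g y X ('D_e F y)) (cov_torsion GW oV sF FW a b Vy)).
have Bs a b e : B a b e = B b a e.
  exact: (congr1 (fun X => inner (gN y) X e) (patch_christ_sym NV a b Vy)).
have S a b e : A a b e + A a e b = B a b e + B a e b.
  have BE : 'D_a (fun z => inner (gN z) b e) y = B a b e + B a e b.
    rewrite (derive_inner_cst _ _ _ (patch_diff NV Vy)) (patch_metric NV _ _ _ Vy).
    by congr (_ + _); apply: innerC; exact (patch_sym NV Vy).
  rewrite -BE; refine (etrans (esym _)
    (derive_eq_on _ oV Vy (fun z Vz => esym (iso b e Vz)))).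
  refine (etrans (cov_metric GW sF FW a Vy (sdF b) (sdF e)) _).
  by congr (_ + _); exact: gC.
have alg (a1 a2 a3 a4 a5 a6 b1 b2 b3 b4 b5 b6 : R) : a1 + a2 = b1 + b2 ->
    a3 + a4 = b3 + b4 -> a5 + a6 = b5 + b6 -> a1 = a4 -> a2 = a5 -> a3 = a6 ->
    b1 = b4 -> b2 = b5 -> b3 = b6 -> a1 = b1 by lra.
exact: (alg _ _ _ _ _ _ _ _ _ _ _ _ (S u v w) (S v w u) (S w u v)
  (As u v w) (As u w v) (As v w u) (Bs u v w) (Bs u w v) (Bs v w u)).
Qed.

(** The scalar form <sigma(u,v), xi>: the tangential part subtracted in sigma is orthogonal to [xi]
    and drops out. *)
Definition sff u v y := g y (D u ('D_v F) y) (xi y).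

(** By [cov_tangential] the left side is orthogonal to every tangent vector, hence a multiple of
    [xi]. *)
Lemma gauss_formula u v y : V y ->
  D u ('D_v F) y - 'D_(christ gN y u v) F y = sff u v y *: xi y.
Proof.
move=> Vy; rewrite {1}(normal_component (X := D u ('D_v F) y - _) Vy).
  by rewrite innerBl xi_normal // subr0.
by move=> w; rewrite innerBl cov_tangential // iso // subrr.
Qed.

Lemma sff_sym u v y : V y -> sff u v y = sff v u y.
Proof.
by move=> Vy; exact: (congr1 (fun X => g y X (xi y)) (cov_torsion GW oV sF FW u v Vy)).
Qed.

Lemma sff_weingarten u v y : V y -> sff u v y = - g y (D u xi y) ('D_v F y).
Proof.
move=> Vy; have := cov_metric GW sF FW u Vy (sdF v) sxi.
have -> : 'D_u (fun z => g z ('D_v F z) (xi z)) y = 0.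
  rewrite (derive_eq_on (g := cst 0) _ oV Vy) ?derive_cst // => z Vz; exact: xi_normal.
rewrite -/(sff u v y) (gC _ (D u xi y)) //; lra.
Qed.

(* [<nabla_u nabla_v F_w, F_z>] is obtained by differentiating [<nabla_v F_w, F_z>],
   so that the second fundamental form need not be differentiated. *)
Lemma gauss_equation u v w z y : V y ->
  inner (gN y) (curvature gN y u v w) z =
  g y (curvature G (F y) ('D_u F y) ('D_v F y) ('D_w F y)) ('D_z F y)
  + sff v w y * sff u z y - sff u w y * sff v z y.
Proof.
move=> Vy.
have alg1 (p1 q r s t h e f : R) : e = p1 + r -> e = f -> f = q + t + s -> r = t + h ->
  p1 = s + q - h by lra.
have alg2 (p1 p2 p3 p4 h1 h2 r k : R) : p1 = p3 - h1 -> p2 = p4 - h2 -> p1 - p2 = r ->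
  p3 - p4 = k -> k = r + h1 - h2 by lra.
have H a b : g y (D a (D b ('D_w F)) y) ('D_z F y) =
    inner (gN y) ('D_a (fun x => christ gN x b w) y + christ gN y a (christ gN y b w)) z
    - sff b w y * sff a z y.
  have sc : differentiable (fun x => christ gN x b w) y.
    exact: (differentiable_christ b w NV Vy).
  pose c0 := christ gN y b w.
  have L : 'D_a (fun x => inner (gN x) (christ gN x b w) z) y =
      inner (gN y) (christ gN y a c0) z + inner (gN y) c0 (christ gN y a z)
      + inner (gN y) ('D_a (fun x => christ gN x b w) y) z.
    have dz : differentiable (cst z : 'rV[R]_p -> 'rV[R]_p) y.
      exact: differentiable_cst.
    refine (etrans (derive_inner a (patch_diff NV Vy) sc dz) _).
    have -> : 'D_a (cst z) y = 0 by exact: derive_cst.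
    by rewrite inner0r addr0 (patch_metric NV _ _ _ Vy).
  have M : g y (D b ('D_w F) y) (D a ('D_z F) y) =
      inner (gN y) c0 (christ gN y a z) + sff b w y * sff a z y.
    have /eqP := gauss_formula b w Vy; rewrite subr_eq => /eqP ->.
    rewrite innerDl innerZl (gC (xi y)) // addrC; congr (_ + _).
    rewrite gC // cov_tangential //; apply: innerC; exact (patch_sym NV Vy).
  have K := cov_metric GW sF FW a Vy (smooth_on_cov GW oV sF FW b (sdF w)) (sdF z).
  have E0 := derive_eq_on a oV Vy (fun x Vx => cov_tangential b w z Vx).
  refine (etrans (alg1 _ _ _ _ _ _ _ _ K E0 L M) _).
  by congr (_ - _); exact: (esym (innerDl _ _ _ _)).
apply: (alg2 _ _ _ _ _ _ _ _ (H u v) (H v u)).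
  refine (etrans (esym (innerBl _ _ _ _)) _).
  exact: (congr1 (fun X => g y X _) (cov_curvature GW oV sF FW u v Vy (sdF w))).
refine (etrans (esym (innerBl _ _ _ _)) _).
exact: (congr1 (fun X => inner (gN y) X z) (esym (curvatureE _ _ _ _))).
Qed.

End Hypersurface.

(** * The Ricci curvature of the structure vector *)

Section RicciDefect.
Context {R : realType}.
Implicit Types a b d k l c : R.

(** The factor 9 undoes the division of the trace by 3. As a (b + d) is already at most a quarter of
    the squared trace, the half taken here leaves enough room for [a] and [b + d] to be forced to
    vanish separately in case of equality; a quarter would only force [a = b + d]. *)
Lemma ricci_defect a b d k l c :
  9 / 2 * ((a + b + d) / 3) ^+ 2 + 2 * c - (2 * c + a * (b + d) - k ^+ 2 - l ^+ 2) =
  (a ^+ 2 + (b + d) ^+ 2) / 2 + (k ^+ 2 + l ^+ 2).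
Proof. by field. Qed.

Lemma ricci_defect_ge0 a b d k l :
  0 <= (a ^+ 2 + (b + d) ^+ 2) / 2 + (k ^+ 2 + l ^+ 2).
Proof. by rewrite addr_ge0 ?divr_ge0 ?addr_ge0 ?sqr_ge0. Qed.

Lemma ricci_defect_eq0 a b d k l c :
  9 / 2 * ((a + b + d) / 3) ^+ 2 + 2 * c - (2 * c + a * (b + d) - k ^+ 2 - l ^+ 2) = 0 ->
  [/\ a = 0, k = 0, l = 0 & b + d = 0].
Proof.
rewrite ricci_defect => /eqP.
rewrite paddr_eq0 ?divr_ge0 ?addr_ge0 ?sqr_ge0 // mulf_eq0 invr_eq0 (pnatr_eq0 _ 2) orbF.
rewrite !paddr_eq0 ?sqr_ge0 // !sqrf_eq0.
by move=> /andP[/andP[/eqP ? /eqP ?] /andP[/eqP ? /eqP ?]].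
Qed.

End RicciDefect.

Section ComplexHypersurface.
Local Opaque cov.
Context {R : realType} {W : set 'rV[R]_(2 + 2)} {G : 'rV[R]_(2 + 2) -> 'M[R]_(2 + 2)}.
Context {V : set 'rV[R]_3} {gN : 'rV[R]_3 -> 'M[R]_3} {F : 'rV[R]_3 -> 'rV[R]_(2 + 2)}.
Context {xi : 'rV[R]_3 -> 'rV[R]_(2 + 2)} {c : R}.
Hypotheses (KW : @kahler_patch R 2 W G)
  (Kc : forall x u, W x -> u != 0 -> sectional G x u (J (m:=2) u) = 4 * c)
  (NV : metric_patch V gN) (sF : smooth_on V F) (FW : forall y, V y -> W (F y)).
Hypotheses (iso : forall y u v, V y ->
    inner (gN y) u v = inner (G (F y)) ('D_u F y) ('D_v F y))
  (sxi : smooth_on V xi)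
  (xi1 : forall y, V y -> inner (G (F y)) (xi y) (xi y) = 1)
  (xi_normal : forall y u, V y -> inner (G (F y)) ('D_u F y) (xi y) = 0).

Local Notation J := (@J R 2).
Local Notation D := (cov (G := G) (F := F)).
Local Notation g y := (inner (G (F y))).
Local Notation h u v y := (sff (G := G) (F := F) (xi := xi) u v y).

Let GW : metric_patch W G. Proof. by case: KW. Qed.
Let oV : open V. Proof. by case: NV. Qed.
Let oW : open W. Proof. by case: GW. Qed.
Let np : (2 + 2 = 3.+1)%N. Proof. by []. Qed.
Let sdF u : smooth_on V ('D_u F). Proof. exact: smooth_on_derive. Qed.
Let gC y X Y : V y -> g y X Y = g y Y X.
Proof. by move=> Vy; apply: innerC; exact (patch_sym GW (FW Vy)). Qed.
Let gp y : V y -> posdef (G (F y)).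
Proof. by move=> Vy; case: GW => _ _ _; apply; exact: FW. Qed.
Let gJ y X Y : V y -> g y (J X) Y = - g y X (J Y).
Proof. by move=> Vy; exact (inner_JN KW X Y (FW Vy)). Qed.
Let gJJ y X Y : V y -> g y (J X) (J Y) = g y X Y.
Proof. by move=> Vy; exact (inner_JJ KW X Y (FW Vy)). Qed.
Let gXJX y X : V y -> g y X (J X) = 0.
Proof. by move=> Vy; rewrite gC //; exact (inner_J_self KW X (FW Vy)). Qed.
Let tangent y X : V y -> g y X (xi y) = 0 -> exists u, 'D_u F y = X.
Proof. exact: (tangent_of_orthogonal np NV sF iso xi1 xi_normal). Qed.

(** In complex dimension 2 the vectors xi, J xi, e, J e form an orthonormal frame. *)
Lemma unit_parseval y e X Y : V y -> g y e (xi y) = 0 -> g y e (J (xi y)) = 0 ->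
  g y e e = 1 ->
  g y X Y = g y X (xi y) * g y Y (xi y) + g y X (J (xi y)) * g y Y (J (xi y))
    + g y X e * g y Y e + g y X (J e) * g y Y (J e).
Proof.
move=> Vy e_xi e_Jxi e1.
pose q (k : 'I_(2 + 2)) := nth 0 [:: xi y; J (xi y); e; J e] k.
have xi_e : g y (xi y) e = 0 by rewrite gC.
have Jxi_e : g y (J (xi y)) e = 0 by rewrite gC.
have xi_Je : g y (xi y) (J e) = 0 by apply: oppr_inj; rewrite -gJ // Jxi_e oppr0.
have Je_xi : g y (J e) (xi y) = 0 by rewrite gC.
have Je_e : g y (J e) e = 0 by rewrite gC // gXJX.
have Jxi_xi : g y (J (xi y)) (xi y) = 0 by rewrite gC // gXJX.
have qo i j : g y (q i) (q j) = (i == j)%:R.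
  case: i => [[|[|[|[|//]]]] ?]; case: j => [[|[|[|[|//]]]] ?]; rewrite /q /=;
  by rewrite ?gJJ // ?gXJX // ?xi1 // ?e1 // ?xi_e ?e_xi ?Jxi_e ?e_Jxi
    ?xi_Je ?Je_xi ?Je_e ?Jxi_xi.
rewrite (frame_parseval (patch_sym GW (FW Vy)) qo) !big_ord_recl big_ord0 addr0 !addrA.
by [].
Qed.

(** The homogeneous form of [unit_parseval], obtained by normalizing [e]; it serves for the
    eigenfield, whose zeros are not known beforehand. *)
Lemma scaled_parseval y e X Y : V y -> g y e (xi y) = 0 -> g y e (J (xi y)) = 0 ->
  g y e e * g y X Y =
  g y e e * (g y X (xi y) * g y Y (xi y) + g y X (J (xi y)) * g y Y (J (xi y)))
    + g y X e * g y Y e + g y X (J e) * g y Y (J e).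
Proof.
move=> Vy e_xi e_Jxi; have [->|e0] := eqVneq e 0.
  have J0 : J 0 = 0 by rewrite -[X in J X](scale0r 0) JZ scale0r.
  by rewrite J0 !inner0r !mul0r !addr0.
have rho : 0 < g y e e by exact: gp.
pose s := (Num.sqrt (g y e e))^-1.
have ss : s * s * g y e e = 1.
  by rewrite /s -invfM -expr2 sqr_sqrtr ?ltW // mulVf // gt_eqF.
have := @unit_parseval y (s *: e) X Y Vy.
rewrite JZ !(innerZl, innerZr) e_xi e_Jxi !mulr0.
move=> /(_ erefl erefl); rewrite mulrA => /(_ ss) ->.
by move: ss; set r := g y e e => ss; transitivity
  (r * (g y X (xi y) * g y Y (xi y) + g y X (J (xi y)) * g y Y (J (xi y)))
   + (s * s * r) * (g y X e * g y Y e)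
   + (s * s * r) * (g y X (J e) * g y Y (J e))); [ring|rewrite ss !mul1r].
Qed.

Lemma holomorphic_frame y : V y ->
  exists u v, 'D_v F y = J ('D_u F y) /\ g y ('D_u F y) ('D_u F y) = 1.
Proof.
move=> Vy.
have [e [e0 e_xi e_Jxi]] : exists e, [/\ e != 0, g y e (xi y) = 0 & g y e (J (xi y)) = 0].
  exact: orthogonal_pair.
have ee : 0 < g y e e by exact: gp.
pose s := (Num.sqrt (g y e e))^-1.
have ss : s * s * g y e e = 1.
  by rewrite /s -invfM -expr2 sqr_sqrtr ?ltW // mulVf // gt_eqF.
have se_xi : g y (s *: e) (xi y) = 0 by rewrite innerZl e_xi mulr0.
have [u uE] := tangent Vy se_xi.
have Jse_xi : g y (J (s *: e)) (xi y) = 0 by rewrite gJ // innerZl e_Jxi mulr0 oppr0.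
have [v vE] := tangent Vy Jse_xi.
by exists u, v; rewrite uE vE; split=> //; rewrite innerZl innerZr mulrA.
Qed.

Lemma structure_tangent y : V y -> exists u, 'D_u F y = J (xi y).
Proof. by move=> Vy; apply: tangent => //; rewrite gC // gXJX. Qed.

Let adapted_orthonormal y e (i j : 'I_3) : V y -> g y e (xi y) = 0 ->
  g y e (J (xi y)) = 0 -> g y e e = 1 ->
  g y (nth 0 [:: J (xi y); e; J e] i) (nth 0 [:: J (xi y); e; J e] j) = (i == j)%:R.
Proof.
move=> Vy e_xi e_Jxi e1.
have Jxi_e : g y (J (xi y)) e = 0 by rewrite gC.
have xi_e : g y (xi y) e = 0 by rewrite gC.
have Je_e : g y (J e) e = 0 by rewrite gC // gXJX.
case: i => [[|[|[|//]]] ?]; case: j => [[|[|[|//]]] ?]; rewrite /=.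
- by rewrite gJJ // xi1.
- exact: Jxi_e.
- by rewrite gJJ.
- exact: e_Jxi.
- exact: e1.
- by rewrite gXJX.
- by rewrite gJJ.
- exact: Je_e.
by rewrite gJJ.
Qed.

(** The plane of [X] and J xi is totally real, so its sectional curvature is c, a quarter of the
    holomorphic one. Two such planes account for the term 2c of the theorem. *)
Let R0_structure y X : V y -> g y X (xi y) = 0 -> g y X (J (xi y)) = 0 -> g y X X = 1 ->
  space_form_tensor (G (F y)) X (J (xi y)) (J (xi y)) X = 1.
Proof.
move=> Vy X_xi X_Jxi X1; rewrite /space_form_tensor JK !(innerNl, innerNr) !gJJ //.
rewrite xi1 // X1 X_Jxi X_xi gXJX //.
ring.
Qed.

Section PointwiseFrame.
Variables (y u e w : 'rV[R]_3).
Hypotheses (Vy : V y) (uE : 'D_u F y = J (xi y)) (wE : 'D_w F y = J ('D_e F y))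
  (e1 : g y ('D_e F y) ('D_e F y) = 1).

Let f (k : 'I_3) := nth 0 [:: u; e; w] k.

Let e_xi : g y ('D_e F y) (xi y) = 0. Proof. exact: xi_normal. Qed.
Let e_Jxi : g y ('D_e F y) (J (xi y)) = 0.
Proof. by apply: oppr_inj; rewrite -gJ // -wE xi_normal // oppr0. Qed.

Let fE (k : 'I_3) : 'D_(f k) F y = nth 0 [:: J (xi y); 'D_e F y; J ('D_e F y)] k.
Proof. by case: k => [[|[|[|//]]] ?]; [exact: uE|exact: erefl|exact: wE]. Qed.

Let fo i j : inner (gN y) (f i) (f j) = (i == j)%:R.
Proof.
refine (etrans (iso _ _ Vy) (etrans (congr2 (g y) (fE i) (fE j)) _)).
exact: adapted_orthonormal.
Qed.

Let hC x z : h x z y = h z x y.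
Proof. exact (sff_sym GW NV sF FW x z Vy). Qed.

Let hE x z : h x z y = - g y (D x xi y) ('D_z F y).
Proof. exact (sff_weingarten GW NV sF FW sxi xi_normal x z Vy). Qed.

(** The Gauss equation summed over the frame [u], [e], [w]. The term of [u] equals its own negative;
    the other two are the curvature of a totally real plane plus a 2 by 2 minor of the second
    fundamental form. *)
Lemma ricci_structure : ricci gN y u u =
  2 * c + h u u y * (h e e y + h w w y) - h u e y ^+ 2 - h u w y ^+ 2.
Proof.
have alg (ric tu te tw a b d k l : R) : ric = tu + (te + (tw + 0)) -> tu = - tu ->
    te = c * 1 + a * b - k * k -> tw = c * 1 + a * d - l * l ->
    ric = 2 * c + a * (b + d) - k ^+ 2 - l ^+ 2.
  by move=> -> t0 -> ->; have -> : tu = 0 by [lra]; ring.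
have K x : g y ('D_x F y) (J (xi y)) = 0 -> g y ('D_x F y) ('D_x F y) = 1 ->
    inner (gN y) (curvature gN y x u u) x = c * 1 + h u u y * h x x y - h u x y * h u x y.
  move=> xJ x1.
  refine (etrans (gauss_equation np GW NV sF FW iso xi1 xi_normal x u u x Vy) _).
  refine (congr2 (fun a b => a + _ - b * _) _ (hC x u)).
  refine (etrans (space_form_curvature KW Kc _ _ _ _ (FW Vy)) _).
  refine (congr1 _ (etrans (congr1 (fun X => space_form_tensor _ _ X X _) uE) _)).
  exact: R0_structure (xi_normal _ Vy) xJ x1.
apply: (alg _ _ _ _ _ _ _ _ _ _ _ (K e e_Jxi e1) (K w _ _)).
- by rewrite (ricci_frame NV u u Vy fo) !big_ord_recl big_ord0.
- refine (etrans (congr1 (fun X => inner (gN y) X u) (curvature_swap y u u u)) _).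
  exact: innerNl.
- by rewrite wE gJJ.
- by rewrite wE gJJ.
Qed.

(** By [frame_invmx] the inverse Gram matrix is the sum of the squares of the frame vectors, so
    contraction with it is the trace in the frame. *)
Lemma trace_structure :
  \sum_a \sum_b invmx (gN y) a b * h (basis_vec a) (basis_vec b) y =
  h u u y + h e e y + h w w y.
Proof.
have lin x z : h x z y = \sum_b z 0 b * h x (basis_vec b) y.
  rewrite hE (derive_basis z (smooth_on_diff sF Vy)) inner_sumr -sumrN.
  by apply: eq_bigr => b _; rewrite innerZr hE mulrN.
have bil x : h x x y = \sum_a \sum_b x 0 a * x 0 b * h (basis_vec a) (basis_vec b) y.
  rewrite lin; apply: eq_bigr => b _; rewrite hC lin mulr_sumr; apply: eq_bigr => a _.
  by rewrite mulrA.
have sum3 (q : 'I_3 -> R) :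
    \sum_k q k = q ord0 + q (lift ord0 ord0) + q (lift ord0 (lift ord0 ord0)).
  by rewrite !big_ord_recl big_ord0 addr0 addrA.
refine (etrans _ (sum3 (fun k => h (f k) (f k) y))).
rewrite (eq_bigr _ (fun k _ => bil (f k))) [RHS]exchange_big /=; apply: eq_bigr => a _.
rewrite [RHS]exchange_big /=; apply: eq_bigr => b _.
exact: (etrans (congr1 (fun t => t * _) (frame_invmx fo a b)) (mulr_suml _ _ _ _)).
Qed.

Local Notation tr := (\sum_a \sum_b invmx (gN y) a b * h (basis_vec a) (basis_vec b) y).

Lemma ricci_structure_le : ricci gN y u u <= 9 / 2 * (tr / 3) ^+ 2 + 2 * c.
Proof.
by rewrite ricci_structure trace_structure -subr_ge0 ricci_defect ricci_defect_ge0.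
Qed.

Lemma ricci_structure_eq : ricci gN y u u = 9 / 2 * (tr / 3) ^+ 2 + 2 * c ->
  [/\ h u u y = 0, h u e y = 0, h u w y = 0 & h e e y + h w w y = 0].
Proof.
move=> H; apply: (ricci_defect_eq0 (c := c)).
by rewrite -trace_structure -ricci_structure H subrr.
Qed.

End PointwiseFrame.

Let Dxi_xi u y : V y -> g y (D u xi y) (xi y) = 0.
Proof.
have alg (a b k : R) : k = a + b -> k = 0 -> b = a -> a = 0 by lra.
move=> Vy; apply: (alg _ _ _ (cov_metric GW sF FW u Vy sxi sxi)); last exact: gC.
refine (etrans (derive_eq_on (g := cst (1 : R)) _ oV Vy (fun z Vz => xi1 Vz)) _).
exact: derive_cst.
Qed.

Lemma equality_rigidity :
  (forall y u, V y -> 'D_u F y = J (xi y) -> ricci gN y u u = 9 / 2 *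
     ((\sum_a \sum_b invmx (gN y) a b * h (basis_vec a) (basis_vec b) y) / 3) ^+ 2
     + 2 * c) ->
  forall y, V y -> c = 0 /\ forall u v, h u v y = 0.
Proof.
move=> Req y0 Vy0.
have hE u v y : V y -> h u v y = - g y (D u xi y) ('D_v F y).
  by move=> Vy; exact (sff_weingarten GW NV sF FW sxi xi_normal u v Vy).
have hC u v y : V y -> h u v y = h v u y.
  by move=> Vy; exact (sff_sym GW NV sF FW u v Vy).
have hZ u v s y : V y -> h u (s *: v) y = s * h u v y.
  by move=> Vy; rewrite !hE // (deriveZ_dir s v (smooth_on_diff sF Vy)) innerZr mulrN.
have A_Jxi u y : V y -> g y (D u xi y) (J (xi y)) = 0.
  move=> Vy; have [U UE] := structure_tangent Vy.
  have [e [w [wE e1]]] := holomorphic_frame Vy.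
  have [a b d _] := ricci_structure_eq Vy UE wE e1 (Req _ _ Vy UE).
  have e_Jxi : g y ('D_e F y) (J (xi y)) = 0.
    by apply: oppr_inj; rewrite -gJ // -wE xi_normal // oppr0.
  have gDU v : g y (D U xi y) ('D_v F y) = - h U v y by rewrite hE // opprK.
  have DU_Jxi : g y (D U xi y) (J (xi y)) = 0 by rewrite -UE gDU a oppr0.
  have DU_e : g y (D U xi y) ('D_e F y) = 0 by rewrite gDU b oppr0.
  have DU_Je : g y (D U xi y) (J ('D_e F y)) = 0 by rewrite -wE gDU d oppr0.
  (* Equality kills the entries of the row of [U] in the frame; by Parseval the whole row vanishes,
     and symmetry of the form turns it into the column that is wanted. *)
  have DU_u : g y (D U xi y) ('D_u F y) = 0.
    rewrite (unit_parseval _ _ Vy (xi_normal e Vy) e_Jxi e1).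
    by rewrite Dxi_xi // DU_Jxi DU_e DU_Je !mul0r !addr0.
  have huU : h u U y = 0.
    refine (etrans (hC u U y Vy) (etrans (hE U u y Vy) _)).
    by rewrite DU_u oppr0.
  apply: oppr_inj; rewrite oppr0 -huU; refine (etrans _ (esym (hE u U y Vy))).
  exact: (congr1 (fun X => - g y _ X) (esym UE)).
have A_trace u v y : V y -> 'D_v F y = J ('D_u F y) ->
    g y (D u xi y) ('D_u F y) + g y (D v xi y) ('D_v F y) = 0.
  move=> Vy vE; have [U UE] := structure_tangent Vy.
  suff : h u u y + h v v y = 0 by rewrite !hE // -opprD => /eqP; rewrite oppr_eq0 => /eqP.
  (* The pointwise equality case concerns unit vectors; a general [u] is rescaled, which is possible
     only if its image is nonzero. *)
  have [u0|u0] := eqVneq ('D_u F y) 0.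
    have J0 : J 0 = 0 by rewrite -[X in J X](scale0r 0) JZ scale0r.
    have h0 x z : 'D_z F y = 0 -> h x z y = 0.
      move=> z0; refine (etrans (hE x z y Vy) _).
      by rewrite z0 inner0r oppr0.
    have v0 : 'D_v F y = 0 := etrans vE (etrans (congr1 J u0) J0).
    exact: (etrans (congr2 +%R (h0 u u u0) (h0 v v v0)) (addr0 0)).
  have uu : 0 < g y ('D_u F y) ('D_u F y) by exact: gp.
  pose s := (Num.sqrt (g y ('D_u F y) ('D_u F y)))^-1.
  have ss : s * (s * g y ('D_u F y) ('D_u F y)) = 1.
    by rewrite /s mulrA -invfM -expr2 sqr_sqrtr ?ltW // mulVf // gt_eqF.
  have dF := smooth_on_diff sF Vy.
  have wE : 'D_(s *: v) F y = J ('D_(s *: u) F y).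
    by rewrite (deriveZ_dir s v dF) (deriveZ_dir s u dF) vE JZ.
  have e1 : g y ('D_(s *: u) F y) ('D_(s *: u) F y) = 1.
    by rewrite (deriveZ_dir s u dF) innerZl innerZr.
  have [_ _ _] := ricci_structure_eq Vy UE wE e1 (Req _ _ Vy UE).
  rewrite !hZ // (hC (s *: u)) // (hC (s *: v)) // !hZ // -!mulrDr => /eqP.
  have s0 : s != 0 by rewrite invr_eq0 sqrtr_eq0 -ltNge.
  by rewrite !mulf_eq0 (negPf s0) => /eqP.
have sG : smooth_on V (fun y => G (F y)).
  by have [_ sG _ _] := GW; exact: (smooth_on_comp oV FW oW sF sG).
have d_cst (u : 'rV[R]_3) (k : R) (y : 'rV[R]_3) : 'D_u (fun=> k) y = 0.
  exact: derive_cst.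
have dZ u (k : R) (f : 'rV[R]_3 -> R) y : V y -> smooth_on V f ->
    'D_u (fun z => k * f z) y = k * 'D_u f y.
  by move=> Vy sf; exact: (deriveZ k (diff_derivable (smooth_on_diff sf Vy))).
have D_curvature u v X Z y : V y -> smooth_on V X ->
    g y (D u (D v X) y - D v (D u X) y) Z =
    c * space_form_tensor (G (F y)) ('D_u F y) ('D_v F y) (X y) Z.
  move=> Vy sX.
  refine (etrans (congr1 (fun Y => g y Y Z) (cov_curvature GW oV sF FW u v Vy sX)) _).
  exact: (space_form_curvature KW Kc _ _ _ _ (FW Vy)).
have rig := @rigidity R 3 2 V (fun y => G (F y)) (fun u => 'D_u F) xi
  (fun u f => 'D_u f) D c
  oV sG sdF sxi (fun u X => smooth_on_cov GW oV sF FW u (X := X))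
  (fun u f k y Vy => derive_eq_on u oV Vy) d_cst dZ
  (fun u X Y y => @cov_metric _ _ _ _ _ _ _ GW sF FW u X Y y)
  (fun u X y => cov_J KW u FW (X := X) (y := y))
  (fun u v y => cov_torsion GW oV sF FW u v (y := y))
  D_curvature gC gp gJ xi1 (fun u y => xi_normal u).
have [c0 h0] := rig (fun y X => @tangent y X) (fun y e X Y => @scaled_parseval y e X Y)
  (fun y => @holomorphic_frame y) (fun u y => @A_Jxi u y)
  (fun u v y => @A_trace u v y) y0 Vy0.
split=> // u v; refine (etrans (hE u v y0 Vy0) _).
by rewrite h0 oppr0.
Qed.

End ComplexHypersurface.

(** * Reading the data in charts *)

Lemma nabla_cst (R : realType) n (G : 'rV[R]_n -> 'M[R]_n) u v x :
  nabla G u (cst v) x = christ G x u v.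
Proof. by rewrite /nabla derive_cst add0r. Qed.

Lemma riemannian_patch (R : realType) n (M : riemannian R n) (j : chart M) :
  metric_patch (chart_map j @` dom j) (metric j).
Proof.
split; first exact: chart_map_open.
- exact: metric_smooth.
- by move=> _ [q jq <-]; exact: metric_symmetric.
by move=> _ [q jq <-] u; exact: metric_pos.
Qed.

Lemma kahler_patch_chart (R : realType) m (M : riemannian R (m + m)) (j : chart M) :
  kahler M -> @kahler_patch R m (chart_map j @` dom j) (metric j).
Proof.
move=> [_ herm par]; split; first exact: riemannian_patch.
- by move=> _ u v [q jq <-]; exact: herm.
move=> _ u v [q jq <-]; have := par j q u v jq.
by rewrite !nabla_cst.
Qed.

Section ChartPair.
Context {R : realType} {n m : nat} {N : manifold R n} {M : manifold R m} {f : N -> M}.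
Hypothesis cf : continuous f.

(** Inside the open image of [dom i], the set is the preimage of [dom j] under the continuous map
    [f \o chart_inv i]. *)
Lemma chart_pair_open (i : chart N) (j : chart M) :
  open (chart_map i @` (dom i `&` f @^-1` dom j)).
Proof.
rewrite openE => _ [p [ip jp] <-]; rewrite /interior.
have oi : open (chart_map i @` dom i) by exact: chart_map_open.
have Ui : (chart_map i @` dom i) (chart_map i p) by exists p.
have n1 : nbhs (chart_map i p) (chart_map i @` dom i) by exact: open_nbhs_nbhs.
have cfi : {for chart_map i p, continuous (f \o chart_inv i)}.
  by apply: continuous_comp; [exact: chart_inv_continuous|exact: cf].
have n2 : nbhs (chart_map i p) ((f \o chart_inv i) @^-1` dom j).
  apply: cfi; apply: open_nbhs_nbhs; split; first exact: dom_open.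
  by rewrite /= chart_mapK.
apply: filterS2 n1 n2 => _ [q iq <-] /=; rewrite chart_mapK // => jq.
by exists q.
Qed.

End ChartPair.

Section LocalTheorem.
Context {R : realType} {c : R} {M : riemannian R (2 + 2)}.
Context {N : riemannian R 3} {f : N -> M}.
Context {xi : chart M -> N -> 'rV[R]_(2 + 2)}.
Hypotheses (kM : kahler M) (cM : constant_holomorphic_curvature M (4 * c))
  (hf : isometric_immersion f) (hxi : unit_normal_field f xi).
Variables (i : chart N) (j : chart M).

Let W := chart_map j @` dom j.
Let V := chart_map i @` (dom i `&` f @^-1` dom j).
Let F := chart_map j \o f \o chart_inv i.
Let nu := xi j \o chart_inv i.

Let FE p : dom i p -> F (chart_map i p) = chart_map j (f p).
Proof. by move=> ip; rewrite /F /= chart_mapK. Qed.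
Let nuE p : dom i p -> nu (chart_map i p) = xi j p.
Proof. by move=> ip; rewrite /nu /= chart_mapK. Qed.

Let KW : @kahler_patch R 2 W (metric j). Proof. exact: kahler_patch_chart. Qed.
Let Kc x u : W x -> u != 0 -> sectional (metric j) x u (J (m:=2) u) = 4 * c.
Proof. by move=> [q jq <-] u0; exact: cM. Qed.
Let NV : metric_patch V (metric i).
Proof.
have [_ sg gT gpos] := riemannian_patch i.
have VU : V `<=` chart_map i @` dom i by move=> _ [p [ip _] <-]; exists p.
split.
- by case: hf => -[cf _] _; exact: chart_pair_open.
- exact: smooth_on_sub VU sg.
- by move=> x /VU; exact: gT.
by move=> x /VU; exact: gpos.
Qed.
Let sF : smooth_on V F. Proof. by case: hf => -[_ + _]; apply. Qed.
Let FW y : V y -> W (F y).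
Proof. by move=> [p [ip jp] <-]; rewrite FE //; exists (f p). Qed.
Let iso y u v : V y ->
  inner (metric i y) u v = inner (metric j (F y)) ('D_u F y) ('D_v F y).
Proof. by move=> [p [ip jp] <-]; rewrite FE //; case: hf => _; apply. Qed.
Let snu : smooth_on V nu. Proof. by case: hxi => -[_ + _]; apply. Qed.
Let nu1 y : V y -> inner (metric j (F y)) (nu y) (nu y) = 1.
Proof.
by move=> [p [ip jp] <-]; rewrite FE // nuE //; have [_ /(_ i j p ip jp)[]] := hxi.
Qed.
Let nu_normal y u : V y -> inner (metric j (F y)) ('D_u F y) (nu y) = 0.
Proof.
move=> Vy; rewrite (innerC _ _ (patch_sym (riemannian_patch j) (FW Vy))).
move: Vy => [p [ip jp] <-]; rewrite FE // nuE //.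
by have [_ /(_ i j p ip jp)[_]] := hxi; apply.
Qed.

Local Notation h u v y := (sff (G := metric j) (F := F) (xi := nu) u v y).

Lemma second_fundamental_formE p u v : dom i p -> dom j (f p) ->
  second_fundamental_form f i j p u v = h u v (chart_map i p) *: xi j p.
Proof.
move=> ip jp; have Vy : V (chart_map i p) by exists p.
rewrite -(nuE ip).
refine (etrans _ (gauss_formula (erefl : (2 + 2 = 3.+1)%N) (riemannian_patch j)
  NV sF FW iso nu1 nu_normal u v Vy)).
rewrite /second_fundamental_form -/F.
refine (congr1 (fun z => _ - 'D_z F _) (nabla_cst _ _ _ _)).
Qed.

Lemma mean_curvature_sqE p : dom i p -> dom j (f p) ->
  mean_curvature_sq f i j p = ((\sum_a \sum_b invmx (metric i (chart_map i p)) a b *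
    h (basis_vec a) (basis_vec b) (chart_map i p)) / 3) ^+ 2.
Proof.
move=> ip jp; have Vy : V (chart_map i p) by exists p.
set t := \sum_a _.
have -> : mean_curvature_sq f i j p =
    metric_at f j p ((t / 3) *: xi j p) ((t / 3) *: xi j p).
  suff HE : mean_curvature_vector f i j p = (t / 3) *: xi j p.
    by rewrite /mean_curvature_sq HE.
  rewrite /mean_curvature_vector [t / 3]mulrC -scalerA; congr (_ *: _).
  rewrite scaler_suml; apply: eq_bigr => a _; rewrite scaler_suml; apply: eq_bigr => b _.
  by rewrite second_fundamental_formE // scalerA.
have := nu1 Vy; rewrite FE // nuE // /metric_at innerZl innerZr => ->.
by rewrite mulr1 expr2.
Qed.

Let tangent_mapE p u : dom i p -> tangent_map f i j p u = J (m := 2) (xi j p) ->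
  'D_u F (chart_map i p) = J (m := 2) (nu (chart_map i p)).
Proof. by move=> ip uE; rewrite nuE. Qed.

Lemma ricci_le_chart p u : dom i p -> dom j (f p) ->
  tangent_map f i j p u = J (m := 2) (xi j p) ->
  ricci (metric i) (chart_map i p) u u <= 9 / 2 * mean_curvature_sq f i j p + 2 * c.
Proof.
move=> ip jp uE; have Vy : V (chart_map i p) by exists p.
have [e [w [wE e1]]] := holomorphic_frame KW NV sF FW iso nu1 nu_normal Vy.
rewrite mean_curvature_sqE //.
exact: (ricci_structure_le KW Kc NV sF FW iso snu nu1 nu_normal Vy
  (tangent_mapE ip uE) wE e1).
Qed.

Lemma ricci_eq_chart p u : c = 0 -> dom i p -> dom j (f p) ->
  (forall u v, second_fundamental_form f i j p u v = 0) ->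
  tangent_map f i j p u = J (m := 2) (xi j p) ->
  ricci (metric i) (chart_map i p) u u = 9 / 2 * mean_curvature_sq f i j p + 2 * c.
Proof.
move=> c0 ip jp h0 uE; have Vy : V (chart_map i p) by exists p.
have [e [w [wE e1]]] := holomorphic_frame KW NV sF FW iso nu1 nu_normal Vy.
have h_eq0 a b : h a b (chart_map i p) = 0.
  have := nu1 Vy; rewrite nuE // FE // => x1.
  have := congr1 (fun X => inner (metric j (chart_map j (f p))) X (xi j p)) (h0 a b).
  by rewrite /= second_fundamental_formE // innerZl x1 mulr1 inner0l.
rewrite mean_curvature_sqE //.
rewrite (trace_structure KW NV sF FW iso snu nu1 nu_normal Vy (tangent_mapE ip uE) wE e1).
rewrite (ricci_structure KW Kc NV sF FW iso nu1 nu_normal Vy (tangent_mapE ip uE) wE e1).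
by rewrite !h_eq0 c0; field.
Qed.

Lemma equality_rigidity_chart :
  (forall p u, dom i p -> dom j (f p) -> tangent_map f i j p u = J (m := 2) (xi j p) ->
     ricci (metric i) (chart_map i p) u u = 9 / 2 * mean_curvature_sq f i j p + 2 * c) ->
  forall p, dom i p -> dom j (f p) ->
    c = 0 /\ forall u v, second_fundamental_form f i j p u v = 0.
Proof.
move=> Req p ip jp; have Vy : V (chart_map i p) by exists p.
have H y u : V y -> 'D_u F y = J (m := 2) (nu y) ->
    ricci (metric i) y u u = 9 / 2 * ((\sum_a \sum_b invmx (metric i y) a b *
      h (basis_vec a) (basis_vec b) y) / 3) ^+ 2 + 2 * c.
  move=> [q [iq jq] <-] uE; rewrite -mean_curvature_sqE //; apply: Req => //.
  by rewrite -nuE.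
have [c0 h0] := equality_rigidity KW Kc NV sF FW iso snu nu1 nu_normal H Vy.
by split=> // u v; rewrite second_fundamental_formE // h0 scale0r.
Qed.

End LocalTheorem.

Theorem theorem7p1 (R : realType) (c : R)
    (M : riemannian R (2 + 2)) (N : riemannian R 3) (f : N -> M)
    (xi : chart M -> N -> 'rV[R]_(2 + 2))
    (hM : complete_sc_complex_space_form M (4 * c))
    (hN : [set: N] !=set0)
    (hf : isometric_immersion f)
    (hxi : unit_normal_field f xi) :
  (forall (i : chart N) (j : chart M) (p : N) (u : 'rV[R]_3),
      dom i p -> dom j (f p) -> tangent_map f i j p u = J (m := 2) (xi j p) ->
      ricci (metric i) (chart_map i p) u u
        <= 9 / 2 * mean_curvature_sq f i j p + 2 * c) /\
  ((forall (i : chart N) (j : chart M) (p : N) (u : 'rV[R]_3),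
      dom i p -> dom j (f p) -> tangent_map f i j p u = J (m := 2) (xi j p) ->
      ricci (metric i) (chart_map i p) u u
        = 9 / 2 * mean_curvature_sq f i j p + 2 * c) <->
   c = 0 /\ totally_geodesic f).
Proof.
have [kM cM _ _] := hM; split.
  by move=> i j p u; exact: (ricci_le_chart kM cM hf hxi).
split=> [Req|[c0 tg] i j p u ip jp].
  have rig i j := equality_rigidity_chart kM cM hf hxi (Req i j).
  split; last by move=> i j p u v ip jp; have [_] := rig i j p ip jp; apply.
  (* The local result yields [c = 0] at a point of [N], so a point has to be produced. *)
  have [p _] := hN; have [i ip] := dom_cover p; have [j jp] := dom_cover (f p).
  by have [] := rig i j p ip jp.
by apply: (ricci_eq_chart kM cM hf hxi c0 ip jp) => v w; exact: tg.
Qed.
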